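(* The generating series $$\sum_{g\ge2}\big(\chi(\overline{\mathcal M}_{g,0})-\chi(\mathcal M_{g,0})\big)z^{2-2g}$$ is the logarithm of the tau-function $Z^{1D}$ of the KP hierarchy (the partition function of topological 1D gravity, in the KP time variables $T_1,T_2,\dots$) evaluated at the times $$T_n=\frac1{n!}V_n(z),\qquad n\ge1,$$ where $$V_n(z):=\sum_{g=1}^\infty\chi(\mathcal M_{g,n})z^{2-2g-n}\ (n=1,2),\qquad V_n(z):=\sum_{g=0}^\infty\chi(\mathcal M_{g,n})z^{2-2g-n}\ (n\ge3).$$
   Context: The partition function of topological 1D gravity is the formal Gaussian integral $$Z^{1D}:=\frac1{\sqrt{2\pi}}\int dx\,\exp\Big(-\frac12x^2+\sum_{n\ge1}t_{n-1}\frac{x^n}{n!}\Big),$$ i.e. the exponential of the sum is expanded and integrated term by term using $\frac1{\sqrt{2\pi}}\int e^{-x^2/2}x^{m}dx=(m-1)!!$ for even $m$ and $0$ for odd $m$. Its KP time variables are $T_n=t_{n-1}/n!$ ($n\ge1$); it is a known theorem of Nishigaki–Yoneya that $Z^{1D}$ is a tau-function of the KP hierarchy with respect to $(T_1,T_2,\dots)$. $\chi(\mathcal M_{g,n})=(-1)^n\frac{(2g-1)B_{2g}}{(2g)!}(2g+n-3)!$ for $2g-2+n>0$ is the orbifold Euler characteristic of $\mathcal M_{g,n}$ (Harer–Zagier formula), and $\chi(\overline{\mathcal M}_{g,n})$ is that of the Deligne–Mumford moduli space; by Bini–Harer, $\chi(\overline{\mathcal M}_{g,n})=n!\sum_{\Gamma}\frac1{|\mathrm{Aut}(\Gamma)|}\prod_v\chi(\mathcal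 M_{g_v,\mathrm{val}_v})$, the sum being over isomorphism classes of connected stable graphs of genus $g$ with $n$ unlabelled external edges (vertices $v$ have genus $g_v$ and valence $\mathrm{val}_v$ with $2g_v-2+\mathrm{val}_v>0$; the genus of $\Gamma$ is $h^1(\Gamma)+\sum_vg_v$; automorphisms act on vertices and half-edges and may permute external edges). The identity is one of formal series in $z^{-1}$. *)

(* Defs.v *)
From HB Require Import structures.
From mathcomp Require Import all_boot all_order all_algebra all_fingroup.
From mathcomp Require Import boolp classical_sets functions cardinality fsbigop.

Set Implicit Arguments.
Unset Strict Implicit.
Unset Printing Implicit Defensive.

Import Order.TTheory GRing.Theory Num.Theory.
Local Open Scope ring_scope.

(* Formal power series over rat in one variable 'u.  In the generating series
   the variable is 'u = z^-1; all exponents of z that occur are negative.     *)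
Record fps := Fps { fcoef : nat -> rat }.

HB.instance Definition _ := [isNew for fcoef].
HB.instance Definition _ := [Choice of fps by <:].

Lemma fpsP (f g : fps) : fcoef f =1 fcoef g <-> f = g.
Proof. by split=> [/funext E|->//]; apply: val_inj. Qed.

Section FpsRing.
Implicit Types f g h : fps.

Definition fps0 := Fps (fun=> 0).
Definition fps_opp f := Fps (fun k => - fcoef f k).
Definition fps_add f g := Fps (fun k => fcoef f k + fcoef g k).
Definition fps1 := Fps (fun k => (k == 0%N)%:R).
Definition fps_mul f g :=
  Fps (fun k => \sum_(i < k.+1) fcoef f i * fcoef g (k - i)%N).
Definition fps_scale (a : rat) f := Fps (fun k => a * fcoef f k).

Fact fps_addA : associative fps_add.
Proof. by move=> f g h; apply/fpsP => k /=; rewrite addrA. Qed.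
Fact fps_addC : commutative fps_add.
Proof. by move=> f g; apply/fpsP => k /=; rewrite addrC. Qed.
Fact fps_add0 : left_id fps0 fps_add.
Proof. by move=> f; apply/fpsP => k /=; rewrite add0r. Qed.
Fact fps_addN : left_inverse fps0 fps_opp fps_add.
Proof. by move=> f; apply/fpsP => k /=; rewrite addNr. Qed.

HB.instance Definition _ :=
  GRing.isZmodule.Build fps fps_addA fps_addC fps_add0 fps_addN.

Definition fps_trunc n f : {poly rat} := \poly_(i < n.+1) fcoef f i.

Lemma fps_mul_trunc n f g k : (k <= n)%N ->
  fcoef (fps_mul f g) k = (fps_trunc n f * fps_trunc n g)`_k.
Proof.
move=> kn; rewrite coefM; apply: eq_bigr => -[i /= ik] _.
rewrite !coef_poly !ltnS (leq_trans (leq_subr _ _) kn).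
by rewrite (leq_trans (_ : i <= k)%N kn).
Qed.

Fact fps_mulC : commutative fps_mul.
Proof.
move=> f g; apply/fpsP => k.
by rewrite !(fps_mul_trunc _ _ (leqnn k)) mulrC.
Qed.
Fact fps_mulA : associative fps_mul.
Proof.
move=> f g h; apply/fpsP => k.
pose F := fps_trunc k f; pose G := fps_trunc k g; pose H := fps_trunc k h.
have -> : fcoef (fps_mul f (fps_mul g h)) k = (F * (G * H))`_k.
  rewrite coefM; apply: eq_bigr => -[i /= ik] _.
  by rewrite coef_poly ik; congr (_ * _); apply/fps_mul_trunc/leq_subr.
have -> : fcoef (fps_mul (fps_mul f g) h) k = (F * G * H)`_k.
  rewrite coefM; apply: eq_bigr => -[i /= ik] _.
  rewrite /H coef_poly ltnS leq_subr; congr (_ * _).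
  exact: fps_mul_trunc.
by rewrite mulrA.
Qed.
Fact fps_mul1 : left_id fps1 fps_mul.
Proof.
move=> f; apply/fpsP => k /=.
by rewrite big_ord_recl /= mul1r subn0 big1 ?addr0 // => i _; rewrite mul0r.
Qed.
Fact fps_mulDl : left_distributive fps_mul +%R.
Proof.
move=> f g h; apply/fpsP => k /=; rewrite -big_split /=.
by apply: eq_bigr => i _; rewrite mulrDl.
Qed.
Fact fps_1neq0 : fps1 != 0.
Proof. by apply/eqP => /fpsP/(_ 0%N). Qed.

HB.instance Definition _ := GRing.Zmodule_isComNzRing.Build fps
  fps_mulA fps_mulC fps_mul1 fps_mulDl fps_1neq0.

Fact fps_scaleA a b f : fps_scale a (fps_scale b f) = fps_scale (a * b) f.
Proof. by apply/fpsP => k /=; rewrite mulrA. Qed.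
Fact fps_scale1 : left_id 1 fps_scale.
Proof. by move=> f; apply/fpsP => k /=; rewrite mul1r. Qed.
Fact fps_scaleDr : right_distributive fps_scale +%R.
Proof. by move=> a f g; apply/fpsP => k /=; rewrite mulrDr. Qed.
Fact fps_scaleDl f : {morph fps_scale^~ f : a b / a + b}.
Proof. by move=> a b; apply/fpsP => k /=; rewrite mulrDl. Qed.

HB.instance Definition _ := GRing.Zmodule_isLmodule.Build rat fps
  fps_scaleA fps_scale1 fps_scaleDr fps_scaleDl.

Fact fps_scaleAl a f g : a *: (f * g) = (a *: f) * g.
Proof.
apply/fpsP => k /=; rewrite mulr_sumr.
by apply: eq_bigr => i _; rewrite mulrA.
Qed.

HB.instance Definition _ := GRing.Lmodule_isLalgebra.Build rat fps fps_scaleAl.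
HB.instance Definition _ := GRing.Lalgebra_isComAlgebra.Build rat fps.

End FpsRing.

Definition fpsX : fps := Fps (fun k => (k == 1%N)%:R).
Notation "''u'" := fpsX (at level 0) : ring_scope.

(* A family of series is summable for the 'u-adic topology iff each power of
   'u occurs in only finitely many members; the sum is then taken
   coefficientwise.  A coefficient where the family is not summable is 0
   (convention of fsbigop).                                                   *)
Definition fps_summable (I : choiceType) (A : set I) (F : I -> fps) : Prop :=
  forall k, finite_set [set i | A i /\ fcoef (F i) k != 0].

Definition fps_sum (I : choiceType) (A : set I) (F : I -> fps) : fps :=
  Fps (fun k => \sum_(i \in A) fcoef (F i) k).

(* Only meaningful for a series with constant coefficient 1. *)
Definition fps_log (f : fps) : fps :=
  fps_sum [set j : nat | (0 < j)%N]
    (fun j => ((-1) ^+ j.+1 / j%:R) *: (f - 1) ^+ j).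

(* bernoulli_seq n = [:: B_0; ...; B_n]. *)
Fixpoint bernoulli_seq (n : nat) : seq rat :=
  if n is m.+1 then
    let s := bernoulli_seq m in
    rcons s (- (\sum_(k < n) 'C(n.+1, k)%:R * s`_k) / n.+1%:R)
  else [:: 1].

Definition bernoulli (n : nat) : rat := (bernoulli_seq n)`_n.

Lemma size_bernoulli_seq n : size (bernoulli_seq n) = n.+1.
Proof. by elim: n => //= n IHn; rewrite size_rcons IHn. Qed.

Lemma nth_bernoulli_seq n k : (k <= n)%N -> (bernoulli_seq n)`_k = bernoulli k.
Proof.
elim: n => [|n IHn] in k *; first by case: k.
rewrite leq_eqVlt => /predU1P[->//|/= kn].
by rewrite nth_rcons size_bernoulli_seq kn IHn.
Qed.

Lemma bernoulli_recurrence n :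
  \sum_(k < n.+1) 'C(n.+1, k)%:R * bernoulli k = (n == 0%N)%:R.
Proof.
case: n => [|n]; first by rewrite big_ord_recr big_ord0 /= add0r mulr1.
rewrite big_ord_recr /= [bernoulli n.+1]/bernoulli /=.
rewrite nth_rcons size_bernoulli_seq ltnn eqxx binSn mulrC divfK ?pnatr_eq0 //.
apply/eqP; rewrite subr_eq0; apply/eqP/eq_bigr => -[k /= kn] _.
by rewrite nth_bernoulli_seq.
Qed.

(* Orbifold Euler characteristic of M_{g,n} (Harer-Zagier), for 2 < 2 g + n. *)
Definition chiM (g n : nat) : rat :=
  (-1) ^+ n * (((2 * g)%:R - 1) * bernoulli (2 * g) / ((2 * g)`!)%:R)
  * ((2 * g + n - 3)`!)%:R.

(* Stable graphs on the vertex set 'I_nv and the set of half-edges 'I_nh.  The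
   involution on half-edges pairs the two halves of each (internal) edge and
   fixes the external edges.  Vertex genera are bounded by the genus g of the
   graphs under consideration, so that there are finitely many graphs.        *)
Definition graph (g nv nh : nat) : Type :=
  ({ffun 'I_nh -> 'I_nv} * {ffun 'I_nh -> 'I_nh} * {ffun 'I_nv -> 'I_g.+1})%type.

HB.instance Definition _ g nv nh := Finite.on (graph g nv nh).

Section StableGraph.
Variables g nv nh : nat.
Implicit Types (G : graph g nv nh) (v w : 'I_nv) (h : 'I_nh).

Definition root_of G h : 'I_nv := G.1.1 h.
Definition opposite G h : 'I_nh := G.1.2 h.
Definition vgenus G v : nat := G.2 v.

Definition valence G v : nat := #|[set h | root_of G h == v]|.
Definition nlegs G : nat := #|[set h | opposite G h == h]|.
Definition nedges G : nat := #|[set h | opposite G h != h]|./2.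

Definition adjacent G : rel 'I_nv :=
  [rel v w | [exists h, (root_of G h == v) && (root_of G (opposite G h) == w)]].
Definition ncomponents G : nat := n_comp (adjacent G) 'I_nv.

(* Euler's formula: the truncated subtraction is exact. *)
Definition betti1 G : nat := (nedges G + ncomponents G - nv)%N.
Definition graph_genus G : nat := (betti1 G + \sum_v vgenus G v)%N.

Definition stable G : bool := [forall v, (2 < 2 * vgenus G v + valence G v)%N].

Definition stable_graphs (n : nat) : {set graph g nv nh} :=
  [set G | [&& [forall h, opposite G (opposite G h) == h],
               ncomponents G == 1%N, stable G,
               graph_genus G == g & nlegs G == n]].

Definition is_iso G1 G2 (st : 'S_nv * 'S_nh) : bool :=
  [&& [forall h, root_of G2 (st.2 h) == st.1 (root_of G1 h)],
      [forall h, opposite G2 (st.2 h) == st.2 (opposite G1 h)]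
    & [forall v, vgenus G2 (st.1 v) == vgenus G1 v]].

Definition isomorphic : rel (graph g nv nh) :=
  [rel G1 G2 | [exists st, is_iso G1 G2 st]].

Definition graph_aut G : {set 'S_nv * 'S_nh} := [set st | is_iso G G st].

(* One graph in each isomorphism class. *)
Definition stable_graph_reprs (n : nat) : {set graph g nv nh} :=
  let D := stable_graphs n in transversal (equivalence_partition isomorphic D) D.

Definition graph_weight G : rat :=
  (#|graph_aut G|%:R)^-1 * \prod_v chiM (vgenus G v) (valence G v).

End StableGraph.

(* Orbifold Euler characteristic of the Deligne-Mumford space (Bini-Harer),
   for 2 < 2 g + n.  The sum ranges over all numbers of vertices and of
   half-edges; only finitely many terms are non-zero.                         *)
Definition chiMbar (g n : nat) : rat :=
  n`!%:R * \sum_(p \in [set: nat * nat])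
             \sum_(G in stable_graph_reprs g p.1 p.2 n) graph_weight G.

(* (1 / sqrt (2 pi)) * \int exp (- x^2 / 2) x^m dx, i.e. (m - 1)!! for m even. *)
Definition gauss_moment (m : nat) : rat :=
  if odd m then 0 else (\prod_(i < m./2) (2 * i + 1))%:R.

(* Expanding exp (\sum_k t_k x^(k+1) / (k+1)!) as
     \sum_j (1 / j!) \sum_(k_1, ..., k_j) \prod_i (t_(k_i) x^(k_i+1) / (k_i+1)!)
   yields one term for each word [:: k_1; ...; k_j]; its Gaussian integral is: *)
Definition Z1D_term (t : nat -> fps) (s : seq nat) : fps :=
  ((size s)`!%:R^-1 * gauss_moment (\sum_(k <- s) k.+1)) *:
    \prod_(k <- s) (k.+1`!%:R^-1 *: t k).

(* Topological 1D gravity at the times t_0, t_1, ...; only meaningful when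
   the family Z1D_term t is summable.                                        *)
Definition Z1D (t : nat -> fps) : fps := fps_sum [set: seq nat] (Z1D_term t).

(* The times t_(n-1) = n! T_n in terms of KP times (T 0 is not used). *)
Definition KP_times (T : nat -> fps) (k : nat) : fps := k.+1`!%:R *: T k.+1.

(* V_n(z) with 'u = z^-1; for n >= 1 the sum runs over the g with 2 < 2 g + n. *)
Definition V (n : nat) : fps :=
  fps_sum [set g : nat | ((if (n <= 2)%N then 1%N else 0%N) <= g)%N]
    (fun g => chiM g n *: 'u ^+ (2 * g + n - 2)).

(* Main.v *)
Require Import Defs.
From mathcomp Require Import boolp classical_sets cardinality fsbigop.
From mathcomp Require Import all_boot all_order all_algebra all_fingroup.
From mathcomp Require Import zify.
Import GRing.Theory.
Local Open Scope ring_scope.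

(** Why the theorem is true.

    The Gaussian moment of x ^ m counts the perfect matchings of m half-edges
    (card_involution_on), and the iterated Leibniz rule (derivn_prod) turns the
    coefficient of x ^ m in the n-th power of the potential into a sum over the
    maps that attach m half-edges to n vertices. This is Wick's theorem: Z1D is
    the generating function of all graphs, labelled by vertices and half-edges
    and divided by n! m!, in which a vertex of valence n has weight V_n
    (graph_sum_coef, Z1D_graph_sum).

    The logarithm of the sum over all graphs is the sum over connected graphs.
    Let D be u d/du, with u the inverse of z. The weight of a graph is the
    product of the weights of its components, so the Leibniz rule marks a
    component (deriv_weight); cutting the graph along this component leaves a connected
    graph and an arbitrary graph on complementary labels (deriv_graph_sum).
    Hence D Z = D C * Z for the sums Z over all graphs and C over connected
    ones, and as Z has constant coefficient 1 this forces C = log Z (log_unique,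
    connected_series_Z1D).

    It remains to recognise C. Expanding each V_n over the genera chooses a
    genus for each vertex, and a connected graph of genus g without legs then
    has degree 2 g - 2 by Euler's formula (mem_stable_graphs). Orbit counting for
    the group of relabellings converts 1 / (n! m!) into a sum over isomorphism
    classes weighted by 1 / Aut (sum_class_reprs), which is the formula of Bini
    and Harer. The only stable graph without legs that the integral does not see
    is the isolated vertex of genus g, since the potential has no term of degree
    0 in x; it contributes the Euler characteristic of the open moduli space, hence
    the difference in the theorem (chiMbarE).

    All infinite sums are locally finite because a vertex of valence n has
    degree at least max(1, n - 2) in u: a graph with n vertices and m half-edges
    has degree at least max(n, m / 3) (low_size_sum). *)

Set Implicit Arguments.
Unset Strict Implicit.
Unset Printing Implicit Defensive.

(** * Power series, the derivation u d/du and the logarithm *)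

Lemma fcoefN f k : fcoef (- f) k = - fcoef f k. Proof. by []. Qed.
Lemma fcoefD f g k : fcoef (f + g) k = fcoef f k + fcoef g k.
Proof. by []. Qed.
Lemma fcoefZ a f k : fcoef (a *: f) k = a * fcoef f k. Proof. by []. Qed.
Lemma fcoefM f g k :
  fcoef (f * g) k = \sum_(i < k.+1) fcoef f i * fcoef g (k - i)%N.
Proof. by []. Qed.
Lemma fcoef1 k : fcoef 1 k = (k == 0%N)%:R. Proof. by []. Qed.
Lemma fcoef_sum I (r : seq I) (P : pred I) (F : I -> fps) k :
  fcoef (\sum_(i <- r | P i) F i) k = \sum_(i <- r | P i) fcoef (F i) k.
Proof. exact: (big_morph (fcoef^~ k)). Qed.

Lemma fcoefXn d k : fcoef ('u ^+ d) k = (k == d)%:R.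
Proof.
elim: d k => [|d IH] k; first by rewrite expr0.
rewrite exprS fcoefM; case: k => [|k].
  by rewrite big_ord_recl big_ord0 /= mul0r addr0.
rewrite big_ord_recl /= mul0r add0r big_ord_recl /= mul1r big1 ?addr0 => [|i _].
  by rewrite IH subSS subn0.
by rewrite mul0r.
Qed.

(** The ideal generated by 'u ^+ d, in which the degree bounds that make all
    sums locally finite are stated. *)
Definition low d (f : fps) := forall k, (k < d)%N -> fcoef f k = 0.

Lemma low0 f : low 0 f. Proof. by []. Qed.
Lemma lowZ d a f : low d f -> low d (a *: f).
Proof. by move=> f0 k kd; rewrite fcoefZ f0 ?mulr0. Qed.
Lemma lowM d e f g : low d f -> low e g -> low (d + e) (f * g).
Proof.
move=> f0 g0 k kd; rewrite fcoefM big1 // => -[i /= ik] _.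
have [/f0->|di] := ltnP i d; first by rewrite mul0r.
rewrite g0 ?mulr0 // ltn_subLR //; exact: leq_trans kd (leq_add _ _).
Qed.
Lemma low_sum d I (r : seq I) (P : pred I) (F : I -> fps) :
  (forall i, P i -> low d (F i)) -> low d (\sum_(i <- r | P i) F i).
Proof. by move=> F0 k kd; rewrite fcoef_sum big1 // => i /F0->. Qed.
Lemma low_prod I (r : seq I) (P : pred I) (d : I -> nat) (F : I -> fps) :
  (forall i, P i -> low (d i) (F i)) ->
  low (\sum_(i <- r | P i) d i) (\prod_(i <- r | P i) F i).
Proof.
move=> F0; elim/big_rec2: _ => [|i e f Pi IH]; first exact: low0.
by apply: lowM => //; apply: F0.
Qed.
Lemma low_exp d f n : low d f -> low (d * n) (f ^+ n).
Proof.
move=> f0; elim: n => [|n IH]; first by rewrite muln0.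
by rewrite exprS mulnS; apply: lowM.
Qed.

(** The derivation u d/du rather than d/du: it preserves the order in 'u,
    so that truncated identities stay exact. *)
Definition fps_deriv (f : fps) := Fps (fun k => k%:R * fcoef f k).
Local Notation "''D' f" := (fps_deriv f) (at level 8, f at level 8).

Lemma fcoef_deriv f k : fcoef ('D f) k = k%:R * fcoef f k. Proof. by []. Qed.
Lemma fderivD f g : 'D (f + g) = 'D f + 'D g.
Proof. by apply/fpsP => k /=; rewrite mulrDr. Qed.
Lemma fderivB f g : 'D (f - g) = 'D f - 'D g.
Proof. by apply/fpsP => k /=; rewrite mulrDr mulrN. Qed.
Lemma fderiv0 : 'D 0 = 0.
Proof. by apply/fpsP => k /=; rewrite mulr0. Qed.
Lemma fderiv1 : 'D 1 = 0.
Proof. by apply/fpsP => -[|k] /=; rewrite ?mul0r ?mulr0. Qed.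
Lemma fderivZ a f : 'D (a *: f) = a *: 'D f.
Proof. by apply/fpsP => k /=; rewrite mulrCA. Qed.
Lemma fderiv_sum I (r : seq I) (P : pred I) (F : I -> fps) :
  'D (\sum_(i <- r | P i) F i) = \sum_(i <- r | P i) 'D (F i).
Proof. exact: (big_morph fps_deriv fderivD fderiv0). Qed.
Lemma fderivM f g : 'D (f * g) = 'D f * g + f * 'D g.
Proof.
apply/fpsP => k; rewrite fcoefD !fcoefM fcoef_deriv fcoefM mulr_sumr -big_split.
apply: eq_bigr => -[i /= ik] _.
by rewrite -{1}(subnKC (ik : (i <= k)%N)) natrD mulrDl -mulrA (mulrCA (fcoef f i)).
Qed.
Lemma fderivX f n : 'D (f ^+ n.+1) = n.+1%:R *: (f ^+ n * 'D f).
Proof.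
elim: n => [|n IH]; first by rewrite scale1r mul1r.
rewrite exprS fderivM IH -scalerAr mulrA -exprS mulrC.
by rewrite -[n.+2%:R]nat1r scalerDl scale1r.
Qed.
Lemma low_deriv d f : low d f -> low d ('D f).
Proof. by move=> f0 k kd; rewrite fcoef_deriv f0 ?mulr0. Qed.

Lemma fderiv_prod (I : finType) (P : pred I) (F : I -> fps) :
  'D (\prod_(i | P i) F i) =
  \sum_(i | P i) 'D (F i) * \prod_(j | P j && (j != i)) F j.
Proof.
have gen (r : seq I) : uniq r -> 'D (\prod_(i <- r | P i) F i) =
    \sum_(i <- r | P i) 'D (F i) * \prod_(j <- r | P j && (j != i)) F j.
  elim: r => [|x r IH] /=; first by rewrite !big_nil fderiv1.
  move=> /andP[xr ur]; rewrite !big_cons.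
  have nx i : i \in r -> (x != i) by apply: contraTneq => <-.
  case: ifP => Px; last first.
    rewrite (IH ur) big_seq_cond [RHS]big_seq_cond; apply: eq_bigr => i /andP[ir Pi].
    by rewrite big_cons Px.
  rewrite fderivM (IH ur) eqxx /=; congr (_ * _ + _).
    rewrite big_seq_cond [RHS]big_seq_cond; apply: eq_bigl => j.
    by have [/nx|] //= := boolP (j \in r); rewrite eq_sym => ->; rewrite andbT.
  rewrite mulr_sumr big_seq_cond [RHS]big_seq_cond; apply: eq_bigr => i /andP[ir Pi].
  by rewrite big_cons Px nx //= mulrCA.
exact/gen/index_enum_uniq.
Qed.

(** A series with constant coefficient 1 is not a zero divisor: the lowest
    non-zero coefficient of f survives in f * Z. *)
Lemma fps_lreg_eq0 f Z : fcoef Z 0 = 1 -> f * Z = 0 -> f = 0.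
Proof.
move=> Z0 fZ; apply/fpsP => k; elim/ltn_ind: k => k IH.
have := congr1 (fcoef^~ k) fZ; rewrite fcoefM big_ord_recr /= subnn Z0 mulr1.
by rewrite big1 ?add0r // => -[i /= ik] _; rewrite IH // mul0r.
Qed.

(** The bridge from sums over infinite sets to the ordinary big operators in
    which all computations take place. *)
Lemma fsum_seq (I : choiceType) (A : set I) (r : seq I) (F : I -> rat) :
  uniq r -> (forall i, i \in r -> A i) ->
  (forall i, A i -> i \notin r -> F i = 0) ->
  \sum_(i \in A) F i = \sum_(i <- r) F i.
Proof.
move=> ur rA F0.
rewrite (@fsbigE _ _ _ _ _ r) //; last first.
rewrite big_seq_cond [RHS]big_seq; apply: eq_bigl => i.
by have [/rA/mem_set->|] := boolP (i \in r).
Qed.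

(** Since Z - 1 is divisible by 'u, its powers of exponent above k do not
    reach the coefficient of 'u ^+ k. *)
Lemma fcoef_log Z N k : fcoef Z 0 = 1 -> (k <= N)%N ->
  fcoef (fps_log Z) k =
  fcoef (\sum_(j < N) ((-1) ^+ j / j.+1%:R) *: (Z - 1) ^+ j.+1) k.
Proof.
move=> Z0 kN; rewrite fcoef_sum.
have low1 : low 1 (Z - 1).
  by move=> [|//] _; rewrite fcoefD fcoefN Z0 fcoef1 subrr.
rewrite /fps_log /= (@fsum_seq _ _ (iota 1 N)) ?iota_uniq //; first last.
- move=> j j0; rewrite mem_iota add1n negb_and -!leqNgt /= => /orP[|jN].
    by rewrite leqNgt [(0 < j)%N]j0.
  suff -> : fcoef ((Z - 1) ^+ j) k = 0 by rewrite mulr0.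
  by apply: (low_exp low1); rewrite mul1n (leq_ltn_trans kN).
- by move=> j; rewrite mem_iota => /andP[].
rewrite (iotaDl 1 0) big_map -[iota 0 N](_ : index_iota 0 N = _); last first.
  by rewrite /index_iota subn0.
by rewrite big_mkord; apply: eq_bigr => j _; rewrite add1n !exprS !mulN1r opprK.
Qed.

(** Term by term, D log Z is the geometric series of 1 - Z times D Z, and
    the truncated geometric series is an inverse of Z up to high order. *)
Lemma deriv_log Z : fcoef Z 0 = 1 -> 'D (fps_log Z) * Z = 'D Z.
Proof.
move=> Z0; apply/fpsP => k.
pose y := Z - 1; pose l := \sum_(j < k.+1) ((-1) ^+ j / j.+1%:R) *: y ^+ j.+1.
transitivity (fcoef ('D l * Z) k).
  rewrite !fcoefM; apply: eq_bigr => i _.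
  by rewrite !fcoef_deriv (fcoef_log Z0 (ltnW (ltn_ord i))).
have -> : 'D l = (\sum_(j < k.+1) (- y) ^+ j) * 'D y.
  rewrite fderiv_sum mulr_suml; apply: eq_bigr => j _.
  rewrite fderivZ fderivX scalerA divfK ?Num.Theory.pnatr_eq0 //.
  by rewrite scalerAl -[- y]scaleN1r exprZn.
have lowy : low 1 (- y).
  by move=> [|//] _; rewrite fcoefN fcoefD fcoefN Z0 fcoef1 subrr oppr0.
have -> : 'D y = 'D Z by rewrite fderivB fderiv1 subr0.
have ZE : Z = 1 - - y by rewrite opprK addrC subrK.
have geo : (1 - - y) * (\sum_(j < k.+1) (- y) ^+ j) = 1 - (- y) ^+ k.+1.
  move: (- y) => x; rewrite -[RHS]opprB subrX1 -mulNr.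
  by congr (_ * _); rewrite [RHS]opprB.
rewrite mulrAC mulrC; rewrite -ZE in geo; rewrite [_ * Z]mulrC geo.
rewrite mulrBr mulr1 fcoefD fcoefN.
suff -> : fcoef ('D Z * (- y) ^+ k.+1) k = 0 by rewrite subr0.
by apply: (lowM (@low0 _) (low_exp lowy)); rewrite add0n mul1n.
Qed.

(** The logarithm will only be accessed through this characterisation: in
    characteristic zero the derivation u d/du kills constants only. *)
Lemma log_unique L Z :
  fcoef Z 0 = 1 -> fcoef L 0 = 0 -> 'D L * Z = 'D Z -> L = fps_log Z.
Proof.
move=> Z0 L0 LZ; apply/fpsP => k.
have: 'D (L - fps_log Z) = 0.
  by apply: (fps_lreg_eq0 Z0); rewrite fderivB mulrBl LZ deriv_log // subrr.
move/(congr1 (fcoef^~ k)); case: k => [_|k].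
  by rewrite (@fcoef_log Z 0 0 Z0) // L0 big_ord0.
move/eqP; rewrite fcoef_deriv mulf_eq0 Num.Theory.pnatr_eq0 /= subr_eq0.
by move/eqP.
Qed.

(** * Graphs, their components, and gluing *)

(** Unlike reindex_onto, this does not ask for a left inverse of h, which for
    the gluing of graphs would need default values. *)
Lemma reindex_inj_onto (R : Type) (idx : R) (op : Monoid.com_law idx)
    (I J : finType) (h : J -> I) (P : pred I) (F : I -> R) :
  injective h -> (forall i, P i -> exists j, h j = i) ->
  \big[op/idx]_(i | P i) F i = \big[op/idx]_(j | P (h j)) F (h j).
Proof.
move=> hI hS; rewrite -[RHS](big_imset _ (A := [pred j | P (h j)])) /=; last first.
  by move=> x y _ _ /hI.
apply: eq_bigl => i; apply/idP/imsetP => [Pi|[j Pj ->]]; last exact: Pj.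
by have [j hj] := hS i Pi; exists j; rewrite ?inE hj.
Qed.

Lemma sum_card_subsets (R : nmodType) (T : finType) (g : nat -> R) :
  \sum_(A : {set T}) g #|A| = \sum_(a < #|T|.+1) g a *+ 'C(#|T|, a).
Proof.
rewrite (partition_big (fun A : {set T} => inord #|A| : 'I_#|T|.+1) xpredT) //=.
apply: eq_bigr => a _; rewrite -card_draws -sumr_const.
apply: eq_big => [A|A /eqP <-]; last by rewrite inordK // ltnS max_card.
by rewrite inE -val_eqE /= inordK // ltnS max_card.
Qed.

Local Notation pgraph V H := ({ffun H -> V} * {ffun H -> H})%type.

Definition fpf_inv (H : finType) (s : {ffun H -> H}) : bool :=
  [forall h, (s (s h) == h) && (s h != h)].

Section Pgraph.
Variables V H : finType.
Implicit Types (G : pgraph V H) (A B : {set V}) (v : V) (h : H).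

Definition matching G : bool := fpf_inv G.2.
Definition fiber G v : {set H} := [set h | G.1 h == v].
(** The closed sets of vertices form a Boolean algebra of which the connected
    components are the atoms; phrasing connectedness this way makes it stable
    under gluing and relabelling without any reasoning on paths. *)
Definition closed_in G A : bool :=
  [forall h, (G.1 h \in A) ==> (G.1 (G.2 h) \in A)].
Definition component G A : bool :=
  [&& A != set0, closed_in G A &
    [forall B : {set V}, (B \subset A) ==> closed_in G B ==>
       (B == set0) || (B == A)]].
(** The contribution of the vertices of A; for a component A it depends on
    that component only. *)
Definition cweight (t : nat -> fps) G A : fps := \prod_(v in A) t #|fiber G v|.

Lemma cweightT t G : cweight t G [set: V] = \prod_v t #|fiber G v|.
Proof. by apply: eq_bigl => v; rewrite inE. Qed.

Lemma matchingP G :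
  reflect (forall h, G.2 (G.2 h) = h /\ G.2 h <> h) (matching G).
Proof.
apply: (iffP forallP) => [M h|M h]; have := M h.
  by case/andP => /eqP ? /eqP.
by case=> /eqP-> /eqP->.
Qed.

Lemma closed_inP G A :
  reflect (forall h, G.1 h \in A -> G.1 (G.2 h) \in A) (closed_in G A).
Proof. by apply: (iffP forallP) => c h; have /implyP := c h. Qed.

Lemma closed_inE G A h : matching G -> closed_in G A ->
  (G.1 (G.2 h) \in A) = (G.1 h \in A).
Proof.
move=> /matchingP M /closed_inP c; apply/idP/idP => [/c|/c //].
by have [-> _] := M h.
Qed.

Lemma closed_inC G A : matching G -> closed_in G A -> closed_in G (~: A).
Proof.
by move=> M cA; apply/closed_inP => h; rewrite !inE closed_inE.
Qed.

Lemma componentP G A :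
  reflect [/\ A != set0, closed_in G A &
            forall B, B \subset A -> closed_in G B -> B = set0 \/ B = A]
          (component G A).
Proof.
apply: (iffP and3P) => -[A0 cA minA]; split => //.
  by move=> B BA cB; move/forallP/(_ B): minA; rewrite BA cB => /orP[]/eqP;
    [left|right].
by apply/forallP => B; apply/implyP => BA; apply/implyP => /(minA B BA)[]->;
  rewrite eqxx ?orbT.
Qed.

Definition component_of G v : {set V} :=
  \bigcap_(A : {set V} | closed_in G A && (v \in A)) A.

Lemma component_of_mem G v : v \in component_of G v.
Proof. by apply/bigcapP => A /andP[]. Qed.

Lemma component_of_closed G v : closed_in G (component_of G v).
Proof.
apply/closed_inP => h /bigcapP hA; apply/bigcapP => A cA.
by have [/closed_inP + _] := andP cA; apply; apply: hA.
Qed.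

Lemma component_of_sub G v A :
  closed_in G A -> v \in A -> component_of G v \subset A.
Proof. by move=> cA vA; apply: bigcap_inf; rewrite cA. Qed.

(** If a closed B inside the component of v misses v, its complement is a
    closed set around v, hence contains the component, and B is empty. *)
Lemma component_component_of G v : matching G -> component G (component_of G v).
Proof.
move=> M; apply/componentP; split; last 1 first.
- move=> B Bv cB; have [vB|vB] := boolP (v \in B).
    by right; apply/eqP; rewrite eqEsubset Bv component_of_sub.
  left; apply/eqP; rewrite -subset0 -(setICr B) subsetI subxx.
  apply: (subset_trans Bv); apply: component_of_sub; last by rewrite inE.
  exact: closed_inC.
- by apply/set0Pn; exists v; apply: component_of_mem.
exact: component_of_closed.
Qed.

Lemma component_ofE G A v : component G A -> v \in A -> component_of G v = A.
Proof.
move=> /componentP[_ cA minA] vA.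
have [/setP/(_ v)|//] :=
  minA _ (component_of_sub cA vA) (component_of_closed G v).
by rewrite component_of_mem inE.
Qed.

(** Leibniz rule, with the factors of the product grouped by connected
    component. *)
Lemma deriv_weight t G : matching G ->
  'D (cweight t G [set: V]) =
  \sum_(A : {set V} | component G A) 'D (cweight t G A) * cweight t G (~: A).
Proof.
move=> M; rewrite /cweight fderiv_prod.
rewrite (partition_big (component_of G) (component G)) => [|v _] /=; last first.
  exact: component_component_of.
apply: eq_bigr => A cA; rewrite fderiv_prod mulr_suml.
apply: eq_big => [v|v]; rewrite inE /=.
  apply/eqP/idP => [<-|/(component_ofE cA)//]; exact: component_of_mem.
move=> /eqP vA; rewrite -mulrA; congr (_ * _).
rewrite (bigID (mem A)) /=; congr (_ * _); apply: eq_bigl => w; rewrite !inE /=.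
  by rewrite andbC.
have [|wA] := boolP (w \in A); rewrite ?andbF ?andbT //.
by apply: contraNneq wA => ->; rewrite -vA component_of_mem.
Qed.

End Pgraph.

(** Numerator of the exponential generating function, in both vertex and
    half-edge labels, of all graphs; a graph is a root map together with a
    perfect matching of the half-edges. *)
Definition graph_sum (t : nat -> fps) (n m : nat) : fps :=
  \sum_(G : pgraph 'I_n 'I_m | matching G) cweight t G [set: 'I_n].
Definition cgraph_sum (t : nat -> fps) (n m : nat) : fps :=
  \sum_(G : pgraph 'I_n 'I_m | matching G && component G [set: 'I_n])
    cweight t G [set: 'I_n].

Section Glue.
Variables (V1 V2 V H1 H2 H : finType).
Variables (e : V1 + V2 -> V) (e' : V -> V1 + V2).
Variables (k : H1 + H2 -> H) (k' : H -> H1 + H2).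
Hypotheses (eK : cancel e e') (e'K : cancel e' e).
Hypotheses (kK : cancel k k') (k'K : cancel k' k).

(** Disjoint union of two graphs, carried to given label sets V and H by
    the bijections e and k. *)
Definition glue (p : pgraph V1 H1 * pgraph V2 H2) : pgraph V H :=
  ([ffun h => match k' h with inl x => e (inl (p.1.1 x))
                            | inr y => e (inr (p.2.1 y)) end],
   [ffun h => match k' h with inl x => k (inl (p.1.2 x))
                            | inr y => k (inr (p.2.2 y)) end]).

Lemma glue_rootl p x : (glue p).1 (k (inl x)) = e (inl (p.1.1 x)).
Proof. by rewrite ffunE kK. Qed.
Lemma glue_rootr p x : (glue p).1 (k (inr x)) = e (inr (p.2.1 x)).
Proof. by rewrite ffunE kK. Qed.
Lemma glue_oppl p x : (glue p).2 (k (inl x)) = k (inl (p.1.2 x)).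
Proof. by rewrite ffunE kK. Qed.
Lemma glue_oppr p x : (glue p).2 (k (inr x)) = k (inr (p.2.2 x)).
Proof. by rewrite ffunE kK. Qed.
Definition glueE := (glue_rootl, glue_rootr, glue_oppl, glue_oppr).

Let eI : injective e := can_inj eK.
Let kI : injective k := can_inj kK.

Lemma glue_inj : injective glue.
Proof.
move=> [[r1 s1] [r2 s2]] [[r1' s1'] [r2' s2']] E.
congr ((_, _), (_, _)); apply/ffunP => x.
- by have := congr1 (fun G : pgraph V H => G.1 (k (inl x))) E; rewrite !glueE => /eI[].
- by have := congr1 (fun G : pgraph V H => G.2 (k (inl x))) E; rewrite !glueE => /kI[].
- by have := congr1 (fun G : pgraph V H => G.1 (k (inr x))) E; rewrite !glueE => /eI[].
- by have := congr1 (fun G : pgraph V H => G.2 (k (inr x))) E; rewrite !glueE => /kI[].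
Qed.

Let A : {set V} := [set e (inl x) | x : V1].
Let K : {set H} := [set k (inl x) | x : H1].

Lemma mem_left x : (e (inl x) \in A) = true.
Proof. exact: imset_f. Qed.
Lemma mem_right x : (e (inr x) \in A) = false.
Proof. by apply/imsetP => -[y _ /eI]. Qed.
Lemma half_left x : (k (inl x) \in K) = true.
Proof. exact: imset_f. Qed.
Lemma half_right x : (k (inr x) \in K) = false.
Proof. by apply/imsetP => -[y _ /kI]. Qed.

(** A graph with a closed set of vertices A is the disjoint union of the
    graph on A and the graph on its complement: both the root map and the
    matching respect the two blocks. *)
Lemma glue_surj G : matching G -> closed_in G A -> G.1 @^-1: A = K ->
  exists p, glue p = G.
Proof.
move=> M cA GK.
have rootA h : (G.1 h \in A) = (h \in K) by rewrite -GK inE.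
have oppK h : (G.2 h \in K) = (h \in K) by rewrite -!rootA closed_inE.
have /fin_all_exists[r1 r1E] x : exists v, G.1 (k (inl x)) = e (inl v).
  have : G.1 (k (inl x)) \in A by rewrite rootA half_left.
  by case/imsetP => v _ ->; exists v.
have /fin_all_exists[r2 r2E] x : exists v, G.1 (k (inr x)) = e (inr v).
  have : G.1 (k (inr x)) \notin A by rewrite rootA half_right.
  rewrite -[G.1 _]e'K; case: (e' _) => v; first by rewrite mem_left.
  by exists v.
have /fin_all_exists[s1 s1E] x : exists v, G.2 (k (inl x)) = k (inl v).
  have : G.2 (k (inl x)) \in K by rewrite oppK half_left.
  by case/imsetP => v _ ->; exists v.
have /fin_all_exists[s2 s2E] x : exists v, G.2 (k (inr x)) = k (inr v).
  have : G.2 (k (inr x)) \notin K by rewrite oppK half_right.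
  rewrite -[G.2 _]k'K; case: (k' _) => v; first by rewrite half_left.
  by exists v.
exists ((finfun r1, finfun s1), (finfun r2, finfun s2)).
case: G {M cA GK rootA oppK} => r s /= in r1E r2E s1E s2E *.
congr (_, _); apply/ffunP => h; rewrite ffunE /=.
  by rewrite -[h in RHS]k'K; case: (k' h) => x; rewrite ffunE ?r1E ?r2E.
by rewrite -[h in RHS]k'K; case: (k' h) => x; rewrite ffunE ?s1E ?s2E.
Qed.

Lemma matching_glue p : matching (glue p) = matching p.1 && matching p.2.
Proof.
apply/matchingP/andP => [M|[/matchingP M1 /matchingP M2] h].
  split; apply/matchingP => x.
    have := M (k (inl x)); rewrite !glueE => -[/kI[-> ne]].
    by split=> // E; apply: ne; rewrite E.
  have := M (k (inr x)); rewrite !glueE => -[/kI[-> ne]].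
  by split=> // E; apply: ne; rewrite E.
rewrite -[h]k'K; case: (k' h) => x; rewrite !glueE.
  by have [-> ne] := M1 x; split=> // /kI[].
by have [-> ne] := M2 x; split=> // /kI[].
Qed.

Lemma closed_glue p (B : {set V1}) :
  closed_in (glue p) [set e (inl x) | x in B] = closed_in p.1 B.
Proof.
have memB x : (e (inl x) \in [set e (inl x) | x in B]) = (x \in B).
  by apply/imsetP/idP => [[y yB /eI[->]]|xB] //; exists x.
have memBr x : (e (inr x) \in [set e (inl x) | x in B]) = false.
  by apply/imsetP => -[y _ /eI].
apply/closed_inP/closed_inP => c h.
  by have := c (k (inl h)); rewrite !glueE !memB.
by rewrite -[h]k'K; case: (k' h) => x; rewrite !glueE ?memBr // !memB; apply: c.
Qed.

Lemma component_glue p : component (glue p) A = component p.1 [set: V1].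
Proof.
have AE : A = [set e (inl x) | x in [set: V1]].
  by apply/setP => v; apply/imsetP/imsetP => -[x _ ->]; exists x.
apply/componentP/componentP => -[A0 cA minA]; split.
- by apply: contraNneq A0 => V0; rewrite AE V0 imset0.
- by rewrite -(closed_glue p) -AE.
- move=> B _ cB; rewrite -(closed_glue p) in cB.
  have [|BE|BE] := minA _ _ cB.
  + by rewrite AE; apply/imsetS/subsetT.
  + left; apply/setP => x; rewrite inE; apply/negP => xB.
    by have := imset_f (fun x => e (inl x)) xB; rewrite BE inE.
  + right; apply/setP => x; rewrite [RHS]inE.
    by have := mem_left x; rewrite -BE => /imsetP[y yB /eI[->]].
- apply: contraNneq A0 => A0; apply/eqP/setP => x.
  by have := mem_left x; rewrite A0 inE.
- by rewrite AE closed_glue.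
move=> B BA cB; have BE : B = [set e (inl x) | x in [set x | e (inl x) \in B]].
  apply/setP => v; apply/idP/imsetP => [vB|[x + ->]]; last by rewrite inE.
  have /imsetP[x _ vE] := subsetP BA _ vB.
  by exists x; rewrite // inE -vE.
rewrite BE closed_glue in cB.
have [B0|BT] := minA _ (subsetT _) cB; first by left; rewrite BE B0 imset0.
by right; rewrite BE BT AE.
Qed.

Lemma fiber_gluel p x : #|fiber (glue p) (e (inl x))| = #|fiber p.1 x|.
Proof.
rewrite -(card_imset _ (f := fun y => k (inl y))); last by move=> a b /kI[].
apply: eq_card => h; rewrite -[h]k'K inE; case: (k' h) => y; rewrite !glueE.
  apply/eqP/imsetP => [/eI[E]|[z + /kI[->]]]; last by rewrite inE => /eqP->.
  by exists y; rewrite // inE E.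
by apply/eqP/imsetP => [/eI|[z _ /kI]].
Qed.

Lemma fiber_gluer p x : #|fiber (glue p) (e (inr x))| = #|fiber p.2 x|.
Proof.
rewrite -(card_imset _ (f := fun y => k (inr y))); last by move=> a b /kI[].
apply: eq_card => h; rewrite -[h]k'K inE; case: (k' h) => y; rewrite !glueE.
  by apply/eqP/imsetP => [/eI|[z _ /kI]].
apply/eqP/imsetP => [/eI[E]|[z + /kI[->]]]; last by rewrite inE => /eqP->.
by exists y; rewrite // inE E.
Qed.

Lemma cweight_gluel t p : cweight t (glue p) A = cweight t p.1 [set: V1].
Proof.
rewrite /cweight /A big_imset /=; last by move=> a b _ _ /eI[].
by apply: eq_big => [x|x _]; rewrite ?inE ?fiber_gluel.
Qed.

Lemma cweight_gluer t p : cweight t (glue p) (~: A) = cweight t p.2 [set: V2].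
Proof.
have -> : ~: A = [set e (inr x) | x : V2].
  apply/setP => v; rewrite inE -[v]e'K; case: (e' v) => x.
    by rewrite mem_left; symmetry; apply/imsetP => -[y _ /eI].
  by rewrite mem_right imset_f.
rewrite /cweight big_imset /=; last by move=> a b _ _ /eI[].
by apply: eq_big => [x|x _]; rewrite ?inE ?fiber_gluer.
Qed.

Lemma sum_glue t :
  \sum_(G : pgraph V H | [&& matching G, component G A & G.1 @^-1: A == K])
    'D (cweight t G A) * cweight t G (~: A) =
  'D (\sum_(G : pgraph V1 H1 | matching G && component G [set: V1])
        cweight t G [set: V1]) *
  (\sum_(G : pgraph V2 H2 | matching G) cweight t G [set: V2]).
Proof.
rewrite (reindex_inj_onto _ _ glue_inj) => [|G /and3P[M /componentP[_ cA _] /eqP]];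
  last exact: glue_surj.
rewrite fderiv_sum mulr_suml [RHS](eq_bigr (fun G1 => \sum_(G2 : pgraph V2 H2 | matching G2)
  'D (cweight t G1 [set: V1]) * cweight t G2 [set: V2])); last first.
  by move=> G1 _; rewrite mulr_sumr.
rewrite pair_big /=.
apply: eq_big => [p|p _]; last by rewrite cweight_gluel cweight_gluer.
rewrite matching_glue component_glue.
suff -> : (glue p).1 @^-1: A == K by rewrite andbT andbAC.
apply/eqP/setP => h; rewrite inE -[h]k'K; case: (k' h) => x; rewrite !glueE.
  by rewrite mem_left half_left.
by rewrite mem_right half_right.
Qed.

End Glue.

(** The left block must be exactly A, so that A is a component of a graph
    glued along e as soon as the first graph is connected. *)
Lemma split_ord_bij n (A : {set 'I_n}) :
  exists2 e : 'I_#|A| + 'I_#|~: A| -> 'I_n, bijective e &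
    [set e (inl x) | x : 'I_#|A|] = A.
Proof.
pose e (x : 'I_#|A| + 'I_#|~: A|) : 'I_n :=
  match x with inl y => enum_val y | inr y => enum_val y end.
exists e.
  apply: inj_card_bij; last by rewrite card_sum !card_ord cardsC card_ord.
  move=> [x|x] [y|y] /= E; rewrite ?(enum_val_inj E) //.
    by have := enum_valP y; rewrite -E inE enum_valP.
  by have := enum_valP x; rewrite E inE enum_valP.
apply/setP => i; apply/imsetP/idP => [[x _ ->]|iA]; first exact: enum_valP.
by exists (enum_rank_in iA i); rewrite //= enum_rankK_in.
Qed.

(** Exponential formula in differential form: mark a component of the graph,
    then choose its a vertices and b half-edges among n and m; what remains
    is an arbitrary graph. *)
Lemma deriv_graph_sum t n m :
  'D (graph_sum t n m) =
  \sum_(a < n.+1) \sum_(b < m.+1)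
    ('D (cgraph_sum t a b) * graph_sum t (n - a) (m - b)) *+ ('C(n, a) * 'C(m, b)).
Proof.
pose g a b := 'D (cgraph_sum t a b) * graph_sum t (n - a) (m - b).
transitivity (\sum_(A : {set 'I_n}) \sum_(K : {set 'I_m}) g #|A| #|K|).
  rewrite fderiv_sum (eq_bigr _ (fun G => @deriv_weight _ _ t G)).
  rewrite (exchange_big_dep xpredT) //=; apply: eq_bigr => A _.
  rewrite (partition_big (fun G : pgraph 'I_n 'I_m => G.1 @^-1: A) xpredT) //=.
  apply: eq_bigr => K _.
  have [e [e' eK e'K] eA] := split_ord_bij A.
  have [k [k' kK k'K] kA] := split_ord_bij K.
  have := sum_glue eK e'K kK k'K t; rewrite eA kA /g /graph_sum /cgraph_sum.
  have -> : (n - #|A|)%N = #|~: A| by rewrite [RHS]cardsCs setCK card_ord.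
  have -> : (m - #|K|)%N = #|~: K| by rewrite [RHS]cardsCs setCK card_ord.
  by move<-; apply: eq_bigl => G; rewrite andbA.
rewrite (eq_bigr (fun A : {set 'I_n} =>
    \sum_(b < m.+1) g #|A| b *+ 'C(m, b))); last first.
  by move=> A _; rewrite sum_card_subsets card_ord.
rewrite (sum_card_subsets _ (fun a => \sum_(b < m.+1) g a b *+ 'C(m, b))) card_ord.
apply: eq_bigr => a _; rewrite -sumrMnl; apply: eq_bigr => b _.
by rewrite -mulrnA mulnC.
Qed.

(** * The Gaussian integral as a sum over graphs *)

Section Involutions.
Variable T : finType.
Implicit Types (S : {set T}) (s : {perm T}).

Definition involution_on S s : bool :=
  [forall x, (s (s x) == x) && ((s x != x) == (x \in S))].

Lemma involution_onP S s :
  reflect (forall x, s (s x) = x /\ (s x != x) = (x \in S)) (involution_on S s).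
Proof.
apply: (iffP forallP) => i x; first by have /andP[/eqP-> /eqP] := i x.
by have [-> ->] := i x; rewrite !eqxx.
Qed.

(** Multiplying by a transposition of two fixed points adds a 2-cycle; with the
    converse involution_del, the involutions that match x with y are those of
    the remaining points, which is the recursion of double factorials. *)
Lemma involution_add S s x y : x \in S -> y \in S -> x != y ->
  involution_on (S :\ x :\ y) s ->
  involution_on S (tperm x y * s)%g /\ (tperm x y * s)%g x = y.
Proof.
move=> xS yS xy /involution_onP i.
have sx : s x = x by have [_] := i x; rewrite !inE eqxx andbF => /negbFE/eqP.
have sy : s y = y by have [_] := i y; rewrite !inE eqxx => /negbFE/eqP.
split; last by rewrite permM tpermL.
apply/involution_onP => z; rewrite !permM.
case: (tpermP x y z) => [->|->|/eqP zx /eqP zy].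
- by rewrite sy tpermR sx xS eq_sym xy.
- by rewrite sx tpermL sy yS xy.
have [zz zS] := i z; rewrite tpermD ?zz ?zS ?inE ?zx ?zy //.
  by apply: contraNneq zx => /(congr1 s); rewrite zz sx => ->.
by apply: contraNneq zy => /(congr1 s); rewrite zz sy => ->.
Qed.

Lemma involution_del S s x y : x \in S -> involution_on S s -> s x = y ->
  involution_on (S :\ x :\ y) (tperm x y * s)%g.
Proof.
move=> xS /involution_onP i sx.
have sy : s y = x by have [<-] := i x; rewrite sx.
apply/involution_onP => z; rewrite !permM.
case: (tpermP x y z) => [->|->|/eqP zx /eqP zy].
- by rewrite sy tpermL sy eqxx !inE eqxx andbF.
- by rewrite sx tpermR sx eqxx !inE eqxx.
have [zz zS] := i z; rewrite tpermD ?zz ?zS ?inE ?zx ?zy //.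
  by apply: contraNneq zy => E; rewrite -zz -E sx.
by apply: contraNneq zx => E; rewrite -zz -E sy.
Qed.

(** (m - 1)!!, the number of perfect matchings of m points; it vanishes for
    odd m as the Gaussian moments do. *)
Definition double_fact m : nat :=
  if odd m then 0%N else (\prod_(i < m./2) (2 * i + 1))%N.

Lemma card_involution_on S : #|involution_on S| = double_fact #|S|.
Proof.
move: {2}#|S|.+1 (ltnSn #|S|) => n; elim: n S => // n IHn S Sn.
have [->|[x xS]] := set_0Vmem S.
  rewrite cards0 /double_fact /= big_ord0 -(card1 (1%g : {perm T})).
  apply: eq_card => s; rewrite !inE; apply/involution_onP/eqP => [i|-> x].
    by apply/permP => x; rewrite perm1; have [_] := i x; rewrite inE => /negbFE/eqP.
  by rewrite !perm1 eqxx inE.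
rewrite -[LHS]sum1_card (partition_big (fun s : {perm T} => s x) (mem (S :\ x))) /=.
  rewrite (eq_bigr (fun=> double_fact #|S|.-2)) => [|y].
    rewrite sum_nat_const (cardsD1 x S) xS /= add1n /=.
    case: #|_| => [|m]; first by rewrite /double_fact.
    rewrite /double_fact /= negbK; case: ifP => o; first by rewrite muln0.
    rewrite big_ord_recr /= mulnC; congr (_ * _)%N.
    by rewrite mul2n -[in LHS](odd_double_half m) o add0n addn1.
  rewrite !inE => /andP[yx yS].
  have Sxy : #|S :\ x :\ y| = #|S|.-2.
    by rewrite (cardsD1 x S) xS (cardsD1 y (S :\ x)) !inE yx yS.
  rewrite -Sxy -IHn; last first.
    by rewrite Sxy; move: Sn; rewrite (cardsD1 x S) xS; lia.
  rewrite -[RHS]sum1_card (reindex_inj (mulgI (tperm x y))) /=.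
  apply: eq_bigl => s; apply/andP/idP => [[i /eqP sx]|i].
    by have := involution_del xS i sx; rewrite mulgA tperm2 mul1g.
  rewrite eq_sym in yx.
  by have [? ->] := involution_add xS yS yx i.
move=> s /involution_onP i; rewrite !inE.
have [_] := i x; rewrite xS => ->; have [_ <-] := i (s x).
by have [-> +] := i x; rewrite xS eq_sym.
Qed.

End Involutions.

Lemma sum_const_fpf_inv (R : nmodType) (H : finType) (x : R) :
  \sum_(s : {ffun H -> H} | fpf_inv s) x = x *+ double_fact #|H|.
Proof.
rewrite (@reindex_inj_onto _ _ _ _ _ (fun s : {perm H} => [ffun h => s h])); first last.
- move=> s /forallP i; have sK : involutive s by move=> h; have /andP[/eqP] := i h.
  by exists (perm (inv_inj sK)); apply/ffunP => h; rewrite ffunE permE.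
- by move=> s s' /ffunP E; apply/permP => h; have := E h; rewrite !ffunE.
rewrite sumr_const -cardsT -card_involution_on; congr (_ *+ _).
apply: eq_card => s; change (fpf_inv [ffun h => s h] = involution_on [set: H] s).
by apply: eq_forallb => h; rewrite !ffunE inE eqb_id.
Qed.

Lemma gauss_momentE m : gauss_moment m = (double_fact m)%:R.
Proof. by rewrite /gauss_moment /double_fact; case: ifP. Qed.

Section Leibniz.
Variables (R : comNzRingType) (V : finType).
Implicit Types p : V -> {poly R}.

Lemma poly_deriv_prod p :
  (\prod_v p v)^`() = \sum_w \prod_v (p v)^`(w == v).
Proof.
have gen (r : seq V) : uniq r -> (\prod_(v <- r) p v)^`() =
    \sum_(w <- r) \prod_(v <- r) (p v)^`(w == v).
  elim: r => [|x r IH] /=; first by rewrite !big_nil derivC.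
  move=> /andP[xr ur]; rewrite !big_cons derivM eqxx derivn1 (IH ur).
  congr (_ * _ + _).
    rewrite big_seq [RHS]big_seq; apply: eq_bigr => v vr.
    by rewrite (_ : x == v = false) //; apply: contraNF xr => /eqP->.
  rewrite mulr_sumr big_seq [RHS]big_seq; apply: eq_bigr => w wr.
  by rewrite big_cons (_ : w == x = false) //; apply: contraNF xr => /eqP<-.
exact/gen/index_enum_uniq.
Qed.

(** The iterated Leibniz rule: a term records, for each of the m derivations,
    the factor to which it is applied. These records are exactly the root
    maps of m half-edges, and the order of derivation of a factor is the
    valence of the vertex. *)
Lemma derivn_prod p m :
  (\prod_v p v)^`(m) =
  \sum_(r : {ffun 'I_m -> V}) \prod_v (p v)^`(#|[set h | r h == v]|).
Proof.
have cardE n (r : {ffun 'I_n -> V}) v :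
    #|[set h | r h == v]| = (\sum_(h < n) (r h == v))%N.
  by rewrite -sum1dep_card big_mkcond.
elim: m => [|m IH].
  have r0 : {ffun 'I_0 -> V} by apply: finfun => -[].
  rewrite derivn0 (big_pred1 r0) => [|r]; last first.
    by symmetry; apply/eqP/ffunP => -[].
  by apply: eq_bigr => v _; rewrite cardE big_ord0 derivn0.
rewrite derivnS IH raddf_sum.
(* A record of m.+1 derivations, the last of which is stored at ord0. *)
pose ext (x : {ffun 'I_m -> V} * V) : {ffun 'I_m.+1 -> V} :=
  [ffun h => oapp x.1 x.2 (unlift ord0 h)].
rewrite [RHS](@reindex_inj_onto _ _ _ _ _ ext); first last.
- move=> r _; exists ([ffun i => r (lift ord0 i)], r ord0).
  by apply/ffunP => h; rewrite ffunE; case: unliftP => [i|] -> //=; rewrite ffunE.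
- move=> [r w] [r' w'] /ffunP E; congr (_, _).
    by apply/ffunP => i; have := E (lift ord0 i); rewrite !ffunE liftK.
  by have := E ord0; rewrite !ffunE unlift_none.
rewrite -(pair_bigA _ (fun r w => \prod_v (p v)^`(#|[set h | ext (r, w) h == v]|))) /=.
apply: eq_bigr => r _; rewrite poly_deriv_prod; apply: eq_bigr => w _.
apply: eq_bigr => v _.
have -> : #|[set h | ext (r, w) h == v]| = ((w == v) + #|[set h | r h == v]|)%N.
  rewrite !cardE big_ord_recl ffunE unlift_none /=; congr (_ + _)%N.
  by apply: eq_bigr => i _; rewrite ffunE liftK.
by case: (w == v); rewrite ?derivn1 ?derivn0 // add1n derivnS.
Qed.

(** Evaluation of the iterated Leibniz rule at 0. *)
Lemma coef_prod_fact p m :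
  (\prod_v p v)`_m *+ m`! =
  \sum_(r : {ffun 'I_m -> V})
    \prod_v ((p v)`_#|[set h | r h == v]| *+ (#|[set h | r h == v]|)`!).
Proof.
have coef0 (q : {poly R}) n : (q^`(n)).[0] = q`_n *+ n`!.
  by rewrite horner_coef0 coef_derivn addn0 ffactnn.
rewrite -coef0 derivn_prod horner_sum; apply: eq_bigr => r _.
by rewrite horner_prod; apply: eq_bigr => v _.
Qed.

End Leibniz.

Section Z1D.
Variable tau : nat -> fps.
Let t (n : nat) : fps := if n is k.+1 then tau k else 0.
Let c (k : nat) : fps := k.+1`!%:R^-1 *: tau k.

(** Wick's theorem: the matchings are counted by the Gaussian moment, and the
    root maps by a coefficient of the n-th power of the potential, in which
    'X is the integration variable. *)
Lemma graph_sum_coef n m M (P := \poly_(i < M.+1) (if i is k.+1 then c k else 0)) :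
  (m <= M)%N -> (m`!)%:R^-1 *: graph_sum t n m = gauss_moment m *: (P ^+ n)`_m.
Proof.
move=> mM; have -> : graph_sum t n m = gauss_moment m *: ((P ^+ n)`_m *+ m`!).
  rewrite -[in P ^+ n](card_ord n) -prodr_const coef_prod_fact.
  rewrite /graph_sum gauss_momentE scaler_nat -[in double_fact m](card_ord m).
  rewrite -sum_const_fpf_inv exchange_big pair_big_dep /=.
  apply: eq_big => [G|G _] //.
  rewrite /cweight; apply: eq_big => [v|v _]; first by rewrite inE.
  rewrite coef_poly /fiber; set k := #|_|.
  have -> : (k < M.+1)%N.
    by rewrite ltnS (leq_trans _ mM) // -[m in (_ <= m)%N]card_ord max_card.
  case: k => [|k] /=; first by rewrite mul0rn.
  by rewrite -scaler_nat scalerA mulfV ?scale1r // Num.Theory.pnatr_eq0 -lt0n fact_gt0.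
rewrite -scaler_nat !scalerA mulrAC mulVf ?mul1r //.
by rewrite Num.Theory.pnatr_eq0 -lt0n fact_gt0.
Qed.

Hypothesis lowt : forall k, low (maxn 1 (k - 1)) (tau k).

(** A vertex of valence d has degree at least max(1, d - 2), hence at least
    1 and at least d / 3; so the degree bounds the number of vertices and a
    third of the number of half-edges. *)
Lemma low_size_sum (I : finType) (d : I -> nat) (F : I -> fps) j :
  (forall i, low (maxn 1 (d i - 2)) (F i)) ->
  (j < #|I|)%N || (3 * j < \sum_i d i)%N -> fcoef (\prod_i F i) j = 0.
Proof.
move=> lowF jI; apply: (low_prod (fun i _ => lowF i)).
case/orP: jI => [jI|j3].
  by apply: leq_trans jI _; rewrite -sum1_card; apply: leq_sum => i _; lia.
suff : (\sum_i d i <= 3 * \sum_i maxn 1 (d i - 2))%N by lia.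
by rewrite big_distrr /=; apply: leq_sum => i _; lia.
Qed.

Lemma Z1D_term_low s j : (j < size s)%N || (3 * j < \sum_(k <- s) k.+1)%N ->
  fcoef (Z1D_term tau s) j = 0.
Proof.
rewrite /Z1D_term fcoefZ => js.
rewrite (big_nth 0%N) big_mkord in js.
rewrite [X in fcoef X](big_nth 0%N) big_mkord.
rewrite (@low_size_sum _ (fun i : 'I_(size s) => (nth 0 s i).+1)) ?mulr0 ?card_ord // => i.
by apply: lowZ; have := @lowt (nth 0 s i); rewrite subn2 subn1.
Qed.

Definition word n N (f : {ffun 'I_n -> 'I_N}) : seq nat :=
  [seq nat_of_ord (f i) | i <- enum 'I_n].

Definition words N : seq (seq nat) :=
  [seq word f | n <- iota 0 N.+1, f <- enum {ffun 'I_n -> 'I_N}].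

Lemma size_word n N (f : {ffun 'I_n -> 'I_N}) : size (word f) = n.
Proof. by rewrite size_map size_enum_ord. Qed.

Lemma big_word (R : Type) (idx : R) (op : Monoid.com_law idx) n N
    (f : {ffun 'I_n -> 'I_N}) (F : nat -> R) :
  \big[op/idx]_(k <- word f) F k = \big[op/idx]_(i < n) F (f i).
Proof. by rewrite /word big_map big_enum. Qed.

Lemma words_uniq N : uniq (words N).
Proof.
apply: allpairs_uniq_dep => [|n _|]; rewrite ?iota_uniq ?enum_uniq //.
move=> [n f] [n' f'] _ _ /= E.
have nn : n = n' by have := congr1 size E; rewrite !size_word.
subst n'; congr (existT _ _ _); apply/ffunP => i; apply/val_inj.
by move/eq_in_map: E; apply; rewrite mem_enum.
Qed.

Lemma mem_words N s : (size s <= N)%N -> (\sum_(k <- s) k.+1 <= N)%N ->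
  s \in words N.
Proof.
move=> sN kN; apply/allpairsPdep.
have ltN k : k \in s -> (k < N)%N.
  by move=> ks; apply: leq_trans kN; rewrite (big_rem k ks) /= leq_addr.
case: N => [|N] in sN kN ltN *.
  exists 0%N, (finfun (fun i : 'I_0 => i)); split; rewrite ?mem_enum //.
  by case: s sN {kN ltN} => [_|//]; symmetry; apply: size0nil; rewrite size_word.
exists (size s), [ffun i : 'I_(size s) => inord (nth 0%N s i)].
rewrite mem_iota mem_enum ltnS sN; split=> //.
rewrite -[LHS](mkseq_nth 0%N) /mkseq -val_enum_ord -map_comp.
apply: eq_map => i /=; rewrite ffunE inordK //.
by apply/ltN/mem_nth.
Qed.

Lemma Z1D_term_notin N s j : (3 * j <= N)%N -> s \notin words N ->
  fcoef (Z1D_term tau s) j = 0.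
Proof.
move=> jN sN; apply: Z1D_term_low; apply: contraNT sN.
rewrite negb_or -!leqNgt => /andP[sj kj].
by apply: mem_words; [lia|apply: leq_trans jN].
Qed.

Lemma Z1D_summable : fps_summable [set: seq nat] (Z1D_term tau).
Proof.
move=> j; apply: (@sub_finite_set _ _ [set` words (3 * j)]).
  move=> s [_ /eqP s0] /=; apply: contraT => sN.
  by case: s0; apply: (Z1D_term_notin (leqnn _)).
exact: finite_seq.
Qed.

(** Collecting the words by length n and by total degree m in the integration
    variable identifies Z1D with the generating function of all graphs. *)
Lemma Z1D_graph_sum N j : (3 * j <= N)%N ->
  fcoef (Z1D tau) j =
  \sum_(n < N.+1) \sum_(m < N.+1) (n`!%:R * m`!%:R)^-1 * fcoef (graph_sum t n m) j.
Proof.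
move=> jN; rewrite /Z1D /=.
rewrite (fsum_seq (words_uniq N)) => // [|s _]; last exact: Z1D_term_notin.
rewrite big_allpairs_dep -[iota 0 N.+1]/(index_iota 0 N.+1) big_mkord.
apply: eq_bigr => n _; rewrite big_enum /=.
pose P := \poly_(i < N.+1) (if i is k.+1 then c k else 0).
pose S (f : {ffun 'I_n -> 'I_N}) := (\sum_i (f i).+1)%N.
have PE : P = \sum_(k < N) (c k)%:P * 'X^(k.+1).
  rewrite /P poly_def big_ord_recl scale0r add0r; apply: eq_bigr => k _.
  by rewrite mul_polyC.
have Pcoef m : (P ^+ n)`_m = \sum_(f : {ffun 'I_n -> 'I_N} | S f == m) \prod_i c (f i).
  rewrite -[in P ^+ n](card_ord n) -prodr_const PE bigA_distr_bigA /= coef_sum.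
  rewrite [RHS]big_mkcond; apply: eq_bigr => f _.
  rewrite big_split -rmorph_prod -expr_sum coefCM coefXn eq_sym /=.
  by case: eqP => _; rewrite ?mulr1 ?mulr0.
have -> : \sum_(m < N.+1) (n`!%:R * m`!%:R)^-1 * fcoef (graph_sum t n m) j =
    \sum_(m < N.+1) \sum_(f : {ffun 'I_n -> 'I_N} | S f == m)
      n`!%:R^-1 * gauss_moment (S f) * fcoef (\prod_i c (f i)) j.
  apply: eq_bigr => m _; rewrite invfM -mulrA -[_ * fcoef _ _]fcoefZ.
  rewrite (graph_sum_coef n (leq_ord m)) fcoefZ -/P Pcoef fcoef_sum.
  by rewrite !mulr_sumr; apply: eq_bigr => f /eqP->; rewrite mulrA.
rewrite (exchange_big_dep xpredT) //=; apply: eq_bigr => f _.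
rewrite size_word !big_word /=.
have [SN|NS] := ltnP (S f) N.+1.
  by rewrite (big_pred1 (Ordinal SN)) // => m; rewrite -val_eqE eq_sym.
rewrite (@low_size_sum _ (fun i => (f i).+1) (fun i => c (f i))).
- by rewrite mulr0 big1 // => m _; rewrite mulr0.
- by move=> i; apply: lowZ; have := @lowt (f i); rewrite subn2 subn1.
- by apply/orP; right; apply: leq_trans NS; rewrite ltnS.
Qed.

End Z1D.

(** * The logarithm selects the connected graphs *)

Lemma sum_triangle (R : nmodType) N (h : nat -> nat -> R) :
  \sum_(n < N) \sum_(a < n.+1) h a (n - a)%N =
  \sum_(a < N) \sum_(b < N | (a + b < N)%N) h a b.
Proof.
rewrite (eq_bigr (fun n : 'I_N => \sum_(a < N | (a <= n)%N) h a (n - a)%N)); last first.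
  by move=> n _; rewrite (big_ord_widen N (fun a => h a (n - a)%N)).
rewrite (exchange_big_dep xpredT) //=; apply: eq_bigr => a _.
transitivity (\sum_(a <= n < N) h a (n - a)%N).
  by rewrite (@big_nat_widenl _ _ _ a 0) // big_mkord.
rewrite -{1}[nat_of_ord a]add0n big_addn big_mkord.
rewrite (big_ord_widen N (fun i => h a (i + a - a)%N)) ?leq_subr //.
by apply: eq_big => [i|i _]; rewrite ?addnK //= ltn_subRL.
Qed.

Definition box_sum (R : nmodType) N (g : nat -> nat -> R) : R :=
  \sum_(n < N) \sum_(m < N) g n m.

Lemma box_sum_widen (R : nmodType) M N (g : nat -> nat -> R) : (M <= N)%N ->
  (forall n m, (M <= n)%N || (M <= m)%N -> g n m = 0) ->
  box_sum N g = box_sum M g.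
Proof.
move=> MN g0; rewrite /box_sum [RHS](big_ord_widen N (fun n => \sum_(m < M) g n m)) //.
rewrite [RHS]big_mkcond; apply: eq_bigr => n _ /=; case: ltnP => nM.
  rewrite [RHS](big_ord_widen N (fun m => g n m)) // [RHS]big_mkcond.
  by apply: eq_bigr => m _ /=; case: ltnP => // mM; rewrite g0 // mM orbT.
by rewrite big1 // => m _; rewrite g0 // nM.
Qed.

Lemma sum_card_fiber (V H : finType) (G : pgraph V H) :
  (\sum_v #|fiber G v| = #|H|)%N.
Proof.
rewrite -[RHS]sum1_card (partition_big G.1 xpredT) //=; apply: eq_bigr => v _.
by rewrite -sum1_card; apply: eq_bigl => h; rewrite inE.
Qed.

Section ConnectedLog.
Variable t : nat -> fps.
Hypothesis lowt : forall n, low (maxn 1 (n - 2)) (t n).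

Lemma low_cweight n m (G : pgraph 'I_n 'I_m) :
  low (maxn n ((m + 2) %/ 3)) (cweight t G [set: 'I_n]).
Proof.
move=> j jnm; rewrite cweightT.
apply: (@low_size_sum _ (fun v => #|fiber G v|)) => [v|]; first exact: lowt.
rewrite sum_card_fiber !card_ord; lia.
Qed.

Lemma low_graph_sum n m : low (maxn n ((m + 2) %/ 3)) (graph_sum t n m).
Proof. by apply: low_sum => G _; apply: low_cweight. Qed.
Lemma low_cgraph_sum n m : low (maxn n ((m + 2) %/ 3)) (cgraph_sum t n m).
Proof. by apply: low_sum => G _; apply: low_cweight. Qed.

Let z n m : fps := (n`!%:R * m`!%:R)^-1 *: graph_sum t n m.
Let c n m : fps := (n`!%:R * m`!%:R)^-1 *: cgraph_sum t n m.

Lemma fact_neq0 n : n`!%:R != 0 :> rat.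
Proof. by rewrite Num.Theory.pnatr_eq0 -lt0n fact_gt0. Qed.

Lemma bin_div_fact n p : (p <= n)%N ->
  n`!%:R^-1 * 'C(n, p)%:R = p`!%:R^-1 * (n - p)`!%:R^-1 :> rat.
Proof.
move=> pn; apply: (mulfI (fact_neq0 n)); rewrite mulVKf ?fact_neq0 //.
rewrite -(bin_fact pn) !natrM -[RHS]mulrA [X in _ * X]mulrACA.
by rewrite !mulfV ?fact_neq0 // !mulr1.
Qed.

(** In exponential generating functions the binomials of deriv_graph_sum are
    absorbed, so that the marked component and its complement multiply. *)
Lemma deriv_graph_egf n m :
  'D (z n m) = \sum_(a < n.+1) \sum_(b < m.+1) 'D (c a b) * z (n - a) (m - b).
Proof.
rewrite fderivZ deriv_graph_sum scaler_sumr; apply: eq_bigr => a _.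
rewrite scaler_sumr; apply: eq_bigr => b _.
rewrite /z /c fderivZ -scalerAl -scalerAr scalerA -scaler_nat scalerA.
by rewrite !invfM natrM mulrACA !bin_div_fact ?leq_ord // mulrACA.
Qed.

Lemma low_egf n m : low (maxn n ((m + 2) %/ 3)) (z n m).
Proof. exact/lowZ/low_graph_sum. Qed.
Lemma low_cegf n m : low (maxn n ((m + 2) %/ 3)) (c n m).
Proof. exact/lowZ/low_cgraph_sum. Qed.

(** The truncated form of D Z = D C * Z, where Z and C sum over all
    graphs and over connected graphs. The indices that the two sides do not
    share belong to graphs with too many vertices or half-edges to reach
    degree j. *)
Lemma deriv_box_sum N j : (3 * j < N)%N ->
  fcoef ('D (box_sum N z)) j = fcoef ('D (box_sum N c) * box_sum N z) j.
Proof.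
move=> jN.
(* a and b count the vertices and half-edges of the marked component,
   a' and b' those of the rest. *)
pose g a a' b b' := fcoef ('D (c a b) * z a' b') j.
have g0 a a' b b' : (N <= a + a')%N || (N <= b + b')%N -> g a a' b b' = 0.
  move=> ab; apply: (lowM (low_deriv (@low_cegf a b)) (@low_egf a' b')); lia.
transitivity (\sum_(a < N) \sum_(a' < N) \sum_(b < N) \sum_(b' < N) g a a' b b').
  rewrite /box_sum fderiv_sum fcoef_sum.
  transitivity (\sum_(n < N) \sum_(a < n.+1)
      \sum_(m < N) \sum_(b < m.+1) g a (n - a)%N b (m - b)%N).
    apply: eq_bigr => n _; rewrite [RHS]exchange_big fderiv_sum fcoef_sum.
    apply: eq_bigr => m _; rewrite deriv_graph_egf fcoef_sum.
    by apply: eq_bigr => a _; rewrite fcoef_sum.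
  rewrite (sum_triangle N (fun a a' =>
    \sum_(m < N) \sum_(b < m.+1) g a a' b (m - b)%N)).
  apply: eq_bigr => a _; rewrite big_mkcond; apply: eq_bigr => a' _.
  rewrite (sum_triangle N (g a a')); case: ltnP => aa'; last first.
    by rewrite big1 // => b _; rewrite big1 // => b' _; rewrite g0 ?aa'.
  apply: eq_bigr => b _; rewrite big_mkcond; apply: eq_bigr => b' _.
  by case: ltnP => // bb'; rewrite g0 ?bb' ?orbT.
rewrite /box_sum fderiv_sum mulr_suml fcoef_sum; apply: eq_bigr => a _.
rewrite mulr_sumr fcoef_sum; apply: eq_bigr => a' _.
rewrite fderiv_sum mulr_suml fcoef_sum; apply: eq_bigr => b _.
by rewrite mulr_sumr fcoef_sum.
Qed.

Lemma box_sum_coef (w : nat -> nat -> fps) N j :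
  (forall n m, low (maxn n ((m + 2) %/ 3)) (w n m)) -> (3 * j < N)%N ->
  fcoef (box_sum N w) j = box_sum (3 * j).+1 (fun n m => fcoef (w n m) j).
Proof.
move=> loww jN; rewrite -(box_sum_widen jN) => [|n m nm].
  by rewrite /box_sum fcoef_sum; apply: eq_bigr => n _; rewrite fcoef_sum.
by apply: loww; lia.
Qed.

(** In degree j, connected graphs have at most 3 j vertices and at most 3 j
    half-edges. *)
Definition connected_series : fps :=
  Fps (fun j => box_sum (3 * j).+1 (fun n m => fcoef (c n m) j)).

Lemma connected_series_coef0 : fcoef connected_series 0 = 0.
Proof.
rewrite /connected_series /= /box_sum big_ord1 big_ord1.
rewrite fcoef_sum big1 ?mulr0 // => G /andP[_ /componentP[/set0Pn[] []]].
by case.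
Qed.

Lemma connected_series_log (Z : fps) : fcoef Z 0 = 1 ->
  (forall j, fcoef Z j = box_sum (3 * j).+1 (fun n m => fcoef (z n m) j)) ->
  connected_series = fps_log Z.
Proof.
move=> Z0 ZE; apply: log_unique => //; first exact: connected_series_coef0.
apply/fpsP => j; have coefE i : (i <= j)%N ->
    fcoef connected_series i = fcoef (box_sum (3 * j).+1 c) i /\
    fcoef Z i = fcoef (box_sum (3 * j).+1 z) i.
  move=> ij; rewrite (box_sum_coef low_cegf) ?(box_sum_coef low_egf) ?ZE //; lia.
transitivity (fcoef ('D (box_sum (3 * j).+1 c) * box_sum (3 * j).+1 z) j).
  rewrite !fcoefM; apply: eq_bigr => i _; rewrite !fcoef_deriv.
  have [-> _] := coefE i (leq_ord i).
  by have [_ ->] := coefE (j - i)%N (leq_subr _ _).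
by rewrite -deriv_box_sum // !fcoef_deriv; have [_ ->] := coefE j (leqnn j).
Qed.

End ConnectedLog.

Section FreeEnergy.
Variable tau : nat -> fps.
Hypothesis lowt : forall k, low (maxn 1 (k - 1)) (tau k).
Let t (n : nat) : fps := if n is k.+1 then tau k else 0.

Lemma low_shift_times n : low (maxn 1 (n - 2)) (t n).
Proof. by case: n => [|n] //=; have := @lowt n; rewrite subn1 subn2. Qed.

Lemma Z1D_coef0 : fcoef (Z1D tau) 0 = 1.
Proof.
rewrite (@Z1D_graph_sum _ lowt 0) // !big_ord1 mulr1 invr1 mul1r.
have := @graph_sum_coef tau 0 0 0 (leqnn 0).
rewrite expr0 coef1 invr1 scale1r => ->.
by rewrite /gauss_moment /= big_ord0 mul1r.
Qed.

Lemma connected_series_Z1D : connected_series t = fps_log (Z1D tau).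
Proof.
apply: connected_series_log Z1D_coef0 _; first exact: low_shift_times.
by move=> j; rewrite (@Z1D_graph_sum _ lowt (3 * j)).
Qed.

End FreeEnergy.

(** * Connectedness, Euler's inequality and isomorphism classes *)

Section GraphTopology.
Variables V H : finType.
Implicit Types G : pgraph V H.

(** The relation adjacent of stable graphs, on arbitrary finite label sets. *)
Definition adjacent_in G : rel V :=
  [rel v w | [exists h, (G.1 h == v) && (G.1 (G.2 h) == w)]].

(** There is no perfect matching of an odd set, by the count of matchings. *)
Lemma matching_even G : matching G -> odd #|H| = false.
Proof.
move=> M; apply: contraTF isT => oddH.
have := @sum_const_fpf_inv _ H 1%N; rewrite /double_fact oddH mulr0n.
move/eqP; rewrite (bigD1 G.2) //=.
Qed.

Lemma adjacent_in_sym G : matching G -> symmetric (adjacent_in G).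
Proof.
move=> /matchingP M v w; apply/existsP/existsP => -[h /andP[hv hw]];
  by exists (G.2 h); have [-> _] := M h; rewrite hv hw.
Qed.

Lemma closed_connect_in G A v w : closed_in G A -> connect (adjacent_in G) v w ->
  v \in A -> w \in A.
Proof.
move=> /closed_inP cA /connectP[p + ->]; elim: p v => //= x p IH v.
case/andP=> /existsP[h /andP[/eqP<- /eqP<-]] pP /cA; exact: IH.
Qed.

(** The class of a vertex for the connectedness relation is closed, hence
    everything if the whole set is an atom; conversely a closed set that is
    not empty absorbs every path. *)
Lemma ncomp_component G : matching G ->
  (n_comp (adjacent_in G) V == 1%N) = component G [set: V].
Proof.
move=> M; set e := adjacent_in G.
have es : connect_sym e by apply/sym_connect_sym/adjacent_in_sym.
apply/eqP/componentP => [n1|[V0 _ minV]].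
  have conn v w : connect e v w.
    rewrite -(root_connect es); move/eqP: n1; rewrite /n_comp_mem.
    move=> /card1P[r rP]; have := rP (fingraph.root e v); have := rP (fingraph.root e w).
    by rewrite !inE !fingraph.roots_root // => /esym/eqP -> /esym/eqP ->.
  split.
  - apply/set0Pn; move/eqP: n1; rewrite /n_comp_mem => /card1P[r _].
    by exists r; rewrite inE.
  - by apply/closed_inP => h; rewrite !inE.
  move=> B _ cB; have [->|[v vB]] := set_0Vmem B; [by left|right].
  by apply/setP => w; rewrite inE; apply: closed_connect_in (conn v w) vB.
have [v _] := set0Pn _ V0.
rewrite -(n_comp_connect es v); apply: eq_n_comp_r => w.
rewrite inE; have [||/setP/(_ v)|/setP/(_ w)] := minV [set w | connect e v w].
- exact: subsetT.
- apply/closed_inP => h; rewrite !inE => vh; apply: connect_trans vh _.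
  by apply: connect1; apply/existsP; exists h; rewrite !eqxx.
- by rewrite !inE connect0.
by rewrite !inE => ->.
Qed.

(** A connected graph has at least #|V| - 1 edges. Grow a set S of vertices
    one at a time: as long as S is not everything it is not closed, so an
    edge leaves S, and adding its other end creates a new inner edge. *)
Lemma euler_le G : matching G -> component G [set: V] -> (#|V| <= #|H|./2.+1)%N.
Proof.
move=> M cV; have /componentP[/set0Pn[v0 _] _ minV] := cV.
pose inner (S : {set V}) := [set h | (G.1 h \in S) && (G.1 (G.2 h) \in S)].
(* The claim in terms of half-edges: inner S has two of them per inner edge. *)
suff grow n : (n < #|V|)%N -> exists S : {set V},
    #|S| = n.+1 /\ (2 * n <= #|inner S|)%N.
  have V1 : (0 < #|V|)%N by apply/card_gt0P; exists v0.
  have [|S [_ SI]] := grow #|V|.-1; first by rewrite ltn_predL.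
  have := leq_trans SI (max_card _); lia.
elim: n => [|n IHn] nV; first by exists [set v0]; rewrite cards1 muln0.
have [S [Sn SI]] := IHn (ltnW nV).
have /forallPn[h] : ~~ closed_in G S.
  apply/negP => cS; have [S0|ST] := minV S (subsetT _) cS;
    first by rewrite S0 cards0 in Sn.
  by rewrite ST cardsT in Sn; rewrite Sn ltnn in nV.
move/matchingP: M => M.
rewrite negb_imply => /andP[hS hN].
exists (G.1 (G.2 h) |: S); rewrite cardsU1 hN Sn; split=> //.
(* The edge through h is new: its other end lies outside S. *)
have sub : h |: (G.2 h |: inner S) \subset inner (G.1 (G.2 h) |: S).
  apply/subsetP => x; rewrite !inE => /or3P[/eqP->|/eqP->|/andP[-> ->]].
  - by rewrite hS eqxx orbT.
  - by have [-> _] := M h; rewrite eqxx hS orbT.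
  by rewrite !orbT.
apply: leq_trans (subset_leq_card sub).
have [hh /eqP hne] := M h.
rewrite !cardsU1 !inE (negPf hN) hh hS !andbF /= orbF eq_sym hne; lia.
Qed.

End GraphTopology.

Section Orbits.
Variables g nv nh : nat.
Implicit Types (G : graph g nv nh).
Local Notation perms := ({perm 'I_nv} * {perm 'I_nh})%type.

(** The action of the two symmetric groups whose orbits are the isomorphism
    classes and whose stabilisers are the automorphism groups. *)
Definition relabel G (st : perms) : graph g nv nh :=
  ([ffun h => st.1 (root_of G (st.2^-1%g h))],
   [ffun h => st.2 (opposite G (st.2^-1%g h))],
   [ffun v => G.2 (st.1^-1%g v)]).

Lemma is_isoE G1 G2 st : is_iso G1 G2 st = (G2 == relabel G1 st).
Proof.
apply/and3P/eqP => [[/forallP r /forallP s /forallP c]|->].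
  case: G2 r s c => [[r2 s2] c2] r s c; congr (_, _, _); apply/ffunP => x.
  - by rewrite ffunE -(eqP (r _)) permKV.
  - by rewrite ffunE -(eqP (s _)) permKV.
  by apply/val_inj; rewrite ffunE; have /eqP := c (st.1^-1%g x); rewrite permKV.
split; apply/forallP => x; rewrite /root_of /opposite /vgenus /= ffunE permK //.
Qed.

Lemma relabel1 G : relabel G 1%g = G.
Proof.
case: G => [[r s] c]; congr (_, _, _); apply/ffunP => x;
  by rewrite ffunE /= ?invg1 !perm1.
Qed.

Lemma relabelM G : act_morph relabel G.
Proof.
move=> [s1 s2] [s1' s2']; rewrite /relabel /root_of /opposite /=.
by congr (_, _, _); apply/ffunP => x; rewrite !ffunE /= ?ffunE invMg !permM.
Qed.

Definition relabel_action := TotalAction relabel1 (fun G => @relabelM G).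

Lemma isomorphicE G1 G2 :
  isomorphic G1 G2 = (G2 \in orbit relabel_action [set: perms] G1).
Proof.
apply/existsP/orbitP => [[st]|[st _ <-]]; last by exists st; rewrite is_isoE.
by rewrite is_isoE => /eqP->; exists st.
Qed.

Lemma isomorphic_equiv : equivalence_rel (@isomorphic g nv nh).
Proof.
move=> G1 G2 G3; rewrite !isomorphicE orbit_refl; split=> // G12.
by rewrite -(orbit_eqP G12).
Qed.

(** The orbit-stabiliser theorem for relabel. *)
Lemma card_aut_class G :
  (#|[set G' | isomorphic G G']| * #|graph_aut G| = nv`! * nh`!)%N.
Proof.
have := card_orbit_stab relabel_action [set: perms]%G G.
rewrite cardsT card_prod !card_Sn => <-; congr (_ * _)%N.
  by apply: eq_card => G'; rewrite inE isomorphicE.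
apply: eq_card => st; rewrite !inE sub1set inE is_isoE eq_sym //.
Qed.

(** An isomorphism class consists of nv! nh! / #|Aut| labelled graphs, on all
    of which F has the same value. *)
Lemma sum_class_reprs (D : {set graph g nv nh}) (F : graph g nv nh -> rat) :
  (forall G G', isomorphic G G' -> (G \in D) = (G' \in D)) ->
  (forall G G', isomorphic G G' -> F G = F G') ->
  \sum_(G in transversal (equivalence_partition (@isomorphic g nv nh) D) D)
     (#|graph_aut G|%:R)^-1 * F G
  = (nv`!%:R * nh`!%:R)^-1 * \sum_(G in D) F G.
Proof.
move=> invD invF; set P := equivalence_partition _ D.
have eqv : {in D & &, equivalence_rel (@isomorphic g nv nh)}.
  by move=> G1 G2 G3 _ _ _; apply: isomorphic_equiv.
have pP : partition P D := equivalence_partitionP eqv.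
have tP := transversalP pP.
have [/eqP cov triv _] := and3P pP.
transitivity (\sum_(B in P) (nv`!%:R * nh`!%:R)^-1 * \sum_(G in B) F G); last first.
  by rewrite -mulr_sumr -big_trivIset // cov.
rewrite -[in RHS](pblock_transversal tP) (big_imset _ (pblock_inj tP)) /=.
apply: eq_bigr => G GX; have GD := subsetP (transversal_sub tP) _ GX.
have classE G' : (G' \in pblock P G) = (G' \in [set G' | isomorphic G G']).
  rewrite inE; have [G'D|G'D] := boolP (G' \in D).
    exact: pblock_equivalence_partition.
  transitivity false; last first.
    by apply/esym; apply: contraNF G'D => iG; rewrite -(invD _ _ iG).
  apply: contraNF G'D => G'B; rewrite -cov; apply/bigcupP.
  by exists (pblock P G); rewrite ?pblock_mem ?cov.
rewrite (eq_bigl _ _ classE) (eq_bigr (fun=> F G)) => [|G']; last first.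
  by rewrite inE => /invF.
rewrite sumr_const -[F G *+ _]mulr_natl mulrA; congr (_ * _).
rewrite -natrM -(card_aut_class G) natrM invfM mulrAC mulVf ?mul1r //.
rewrite Num.Theory.pnatr_eq0 -lt0n; apply/card_gt0P; exists G.
by rewrite inE isomorphicE orbit_refl.
Qed.

End Orbits.

(** * Stable graphs and Euler characteristics *)

(** For n >= 1 the range of genera in V is the stability condition, and the
    degree k bounds the genus. *)
Lemma V_coef n k M : (k.+2 <= 2 * M)%N ->
  fcoef (V n.+1) k =
  \sum_(g < M | (2 < 2 * g + n.+1)%N && (k == 2 * g + n.+1 - 2)%N) chiM g n.+1.
Proof.
move=> kM; have setE g : ((if (n.+1 <= 2)%N then 1%N else 0%N) <= g)%N =
    (2 < 2 * g + n.+1)%N by case: ifP; lia.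
rewrite /V /= (@fsum_seq _ _ [seq g <- iota 0 M | (2 < 2 * g + n.+1)%N]).
- rewrite big_filter -{1}[M]subn0 -/(index_iota 0 M) big_mkord.
  rewrite [RHS]big_mkcondr; apply: eq_bigr => g _.
  by rewrite fcoefXn; case: eqP => _; rewrite ?mulr1 ?mulr0.
- exact/filter_uniq/iota_uniq.
- by move=> g; rewrite mem_filter => /andP[+ _]; rewrite -setE; apply.
move=> g gA; have g3 : (2 < 2 * g + n.+1)%N by rewrite -setE; exact: gA.
rewrite mem_filter g3 /= mem_iota /= add0n -leqNgt => Mg.
by rewrite fcoefXn (_ : (k == _) = false) ?mulr0 //; apply/eqP; lia.
Qed.

Lemma V_low n : low (maxn 1 (n - 1)) (V n.+1).
Proof.
move=> k kn; rewrite (@V_coef n k k.+2) ?big_pred0 //; last lia.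
by move=> g; apply/negP => /andP[g2 /eqP]; lia.
Qed.

(** The weight of a vertex by its valence. The source term V_0 is absent
    from the Gaussian integral, hence the value 0 at 0. *)
Definition V_times (n : nat) : fps := if n is k.+1 then V k.+1 else 0.

Section Parity.

Definition has_parity (b : bool) (f : fps) := forall k, odd k != b -> fcoef f k = 0.

Lemma has_parityM b b' f f' :
  has_parity b f -> has_parity b' f' -> has_parity (b (+) b') (f * f').
Proof.
move=> pf pf' k kb; rewrite fcoefM big1 // => i _.
have [ib|/pf->] := eqVneq (odd i) b; last by rewrite mul0r.
rewrite pf' ?mulr0 // oddB ?leq_ord // ib.
by apply: contraNneq kb => <-; rewrite addbC addbK.
Qed.

Lemma V_times_parity n : has_parity (odd n) (V_times n).
Proof.
case: n => [|n] k kn; first by [].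
rewrite /V_times (@V_coef n k k.+2) ?big_pred0 //; last lia.
by move=> g; apply/negP => /andP[g2 /eqP kE]; lia.
Qed.

Lemma cweight_parity (W H : finType) (G : pgraph W H) :
  has_parity (odd #|H|) (cweight V_times G [set: W]).
Proof.
rewrite -(sum_card_fiber G) cweightT.
elim/big_rec2: _ => [|v f n _ IH]; first by case.
by rewrite oddD; apply: has_parityM => //; apply: V_times_parity.
Qed.

(** The degree of a graph has the parity of its number of half-edges, which
    is even. *)
Lemma cgraph_sum_odd n m k : odd k -> fcoef (cgraph_sum V_times n m) k = 0.
Proof.
move=> ok; rewrite fcoef_sum big1 // => G /andP[M _].
by apply: cweight_parity; rewrite (matching_even M) ok.
Qed.

End Parity.

Lemma fcoef_prod_eq (I : finType) (F F' : I -> fps) K :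
  (forall i k, (k <= K)%N -> fcoef (F i) k = fcoef (F' i) k) ->
  fcoef (\prod_i F i) K = fcoef (\prod_i F' i) K.
Proof.
move=> FF'; suff: forall k, (k <= K)%N ->
  fcoef (\prod_i F i) k = fcoef (\prod_i F' i) k by apply.
elim/big_rec2: _ => // i f f' _ IH k kK; rewrite !fcoefM; apply: eq_bigr => j _.
by rewrite FF' ?IH //; have := leq_ord j; lia.
Qed.

(** Expanding each V_n attaches a genus to each vertex. A vertex of positive
    valence in degree at most 2 g - 2 has genus at most g, so the bounded
    genera of stable graphs suffice. *)
Lemma cweight_coef g nv nh (p : pgraph 'I_nv 'I_nh) :
  (2 <= g)%N -> (forall v, 0 < #|fiber p v|)%N ->
  fcoef (cweight V_times p [set: 'I_nv]) (2 * g - 2) =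
  \sum_(c : {ffun 'I_nv -> 'I_g.+1} |
      [forall v, 2 < 2 * c v + #|fiber p v|]%N &&
      (\sum_v (2 * c v + #|fiber p v| - 2) == 2 * g - 2)%N)
    \prod_v chiM (c v) #|fiber p v|.
Proof.
move=> g2 p0; rewrite cweightT.
pose x v (c : 'I_g.+1) : rat :=
  if (2 < 2 * c + #|fiber p v|)%N then chiM c #|fiber p v| else 0.
rewrite (@fcoef_prod_eq _ _
  (fun v => \sum_(c : 'I_g.+1) x v c *: 'u ^+ (2 * c + #|fiber p v| - 2))); last first.
  move=> v k kg; rewrite /x; case: #|_| (p0 v) => // n _.
  rewrite /V_times (@V_coef n k g.+1) ?fcoef_sum; last lia.
  rewrite big_mkcond; apply: eq_bigr => c _; rewrite fcoefZ fcoefXn.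
  by case: (2 < _)%N; case: (k == _); rewrite /= ?mulr1 ?mulr0 ?mul0r.
rewrite bigA_distr_bigA fcoef_sum [RHS]big_mkcond; apply: eq_bigr => c _.
rewrite scaler_prod fcoefZ prodrXr fcoefXn eq_sym.
case: (altP forallP) => [cs|] /=; last first.
  by rewrite negb_forall => /existsP[v vN]; rewrite (bigD1 v) //= /x (negPf vN) !mul0r.
rewrite (eq_bigr (fun v => chiM (c v) #|fiber p v|)) => [|v _]; last by rewrite /x cs.
by case: eqP => _; rewrite ?mulr1 ?mulr0.
Qed.

(** Twice Euler's formula: the sum over the vertices counts half-edges, and
    euler_le makes the truncated subtraction in betti1 exact. *)
Lemma mem_stable_graphs g nv nh (G : graph g nv nh) : (2 <= g)%N ->
  (G \in stable_graphs g nv nh 0) =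
  [&& matching G.1, component G.1 [set: 'I_nv], stable G &
      (\sum_v (2 * vgenus G v + valence G v - 2) == 2 * g - 2)%N].
Proof.
move=> g2; rewrite inE /nlegs cards_eq0.
have mE : matching G.1 = [forall h, opposite G (opposite G h) == h] &&
    ([set h | opposite G h == h] == set0).
  apply/forallP/andP => [M|[/forallP inv /eqP/setP l0] h].
    split; first by apply/forallP => h; have /andP[] := M h.
    by apply/eqP/setP => h; rewrite !inE; have /andP[_ /negPf] := M h.
  by have := l0 h; rewrite !inE inv => ->.
rewrite [in RHS]mE -[ncomponents G]/(n_comp (adjacent_in G.1) 'I_nv).
case: (boolP (matching G.1)) => [M|MN]; last first.
  move: mE; rewrite (negPf MN) => /esym/nandP[/negPf->//|/negPf->].
  by rewrite !andbF.
have := esym mE; rewrite M => /andP[-> ->].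
rewrite ncomp_component // andbT /=; case: (boolP (component _ _)) => //= cG.
case: (boolP (stable G)) => //= /forallP stG.
have nc1 : ncomponents G = 1%N by apply/eqP; exact: etrans (ncomp_component M) cG.
have ne : nedges G = nh./2.
  rewrite /nedges -[in RHS](card_ord nh) -cardsT; congr (_./2); apply: eq_card => h.
  by rewrite !inE; have /matchingP/(_ h)[_ /eqP] := M.
have nvE := euler_le M cG; rewrite !card_ord in nvE.
have nhE : (nh = 2 * nh./2)%N.
  have := matching_even M; rewrite card_ord; lia.
have sumE : (\sum_v (2 * vgenus G v + valence G v - 2) + \sum_(v < nv) 2 =
    2 * \sum_v vgenus G v + \sum_v valence G v)%N.
  rewrite big_distrr -!big_split /=.
  by apply: eq_bigr => v _; have := stG v; lia.
have nvS : (\sum_(v < nv) 2 = nv * 2)%N by rewrite sum_nat_const card_ord.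
have nhS : (\sum_v valence G v = nh)%N.
  by rewrite (sum_card_fiber G.1) card_ord.
rewrite nvS nhS in sumE; rewrite /graph_genus /betti1 nc1 ne.
(* E is the number of edges, S the total genus, X the degree of the graph. *)
move: nhE nvE sumE g2; move: (nh./2) (\sum_v _)%N (\sum_v _)%N => E S X.
by clear=> nhE nvE sumE g2; apply/eqP/eqP; lia.
Qed.

Lemma relabel_component g nv nh (G : graph g nv nh) st :
  component G.1 [set: 'I_nv] -> component (relabel G st).1 [set: 'I_nv].
Proof.
move=> /componentP[V0 _ minV]; apply/componentP; split=> //.
  by apply/closed_inP => h; rewrite !inE.
move=> B _ /closed_inP cB.
have [||B0|BT] := minV (st.1 @^-1: B); first exact: subsetT.
- apply/closed_inP => h; rewrite !inE => hB.
  have := cB (st.2 h); rewrite /relabel /= !ffunE /root_of /opposite /= !permK.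
  by rewrite hB; apply.
- left; apply/setP => v; have /setP/(_ (st.1^-1%g v)) := B0.
  by rewrite !inE permKV.
right; apply/setP => v; have /setP/(_ (st.1^-1%g v)) := BT.
by rewrite !inE permKV.
Qed.

Lemma relabel_matching g nv nh (G : graph g nv nh) st :
  matching G.1 -> matching (relabel G st).1.
Proof.
move=> /matchingP M; apply/matchingP => h; rewrite /relabel /= !ffunE.
rewrite /opposite permK; have [-> ne] := M (st.2^-1%g h); rewrite permKV; split=> //.
by move=> E; apply: ne; apply: (perm_inj (s := st.2)); rewrite permKV.
Qed.

Lemma relabel_valence g nv nh (G : graph g nv nh) st v :
  valence (relabel G st) (st.1 v) = valence G v.
Proof.
rewrite /valence -[RHS](card_imset _ (@perm_inj _ st.2)); apply: eq_card => h.
rewrite inE /root_of /relabel /= ffunE (inj_eq perm_inj).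
apply/idP/imsetP => [hv|[x + ->]]; last by rewrite inE permK.
by exists (st.2^-1%g h); rewrite ?inE ?permKV.
Qed.

Lemma relabel_vgenus g nv nh (G : graph g nv nh) st v :
  vgenus (relabel G st) (st.1 v) = vgenus G v.
Proof. by rewrite /vgenus /relabel /= ffunE permK. Qed.

Lemma relabel_stable_graphs g nv nh (G : graph g nv nh) st : (2 <= g)%N ->
  G \in stable_graphs g nv nh 0 -> relabel G st \in stable_graphs g nv nh 0.
Proof.
move=> g2; rewrite !mem_stable_graphs // => /and4P[M cG /forallP sG].
rewrite relabel_matching // relabel_component //= => /eqP <-; apply/andP; split.
  apply/forallP => v; have := sG (st.1^-1%g v).
  by rewrite -(relabel_vgenus G st) -(relabel_valence G st) permKV.
rewrite (reindex_inj (@perm_inj _ st.1)); apply/eqP/eq_bigr => v _.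
by rewrite relabel_vgenus relabel_valence.
Qed.

Definition vertex_product g nv nh (G : graph g nv nh) : rat :=
  \prod_v chiM (vgenus G v) (valence G v).

Lemma relabel_vertex_product g nv nh (G : graph g nv nh) st :
  vertex_product (relabel G st) = vertex_product G.
Proof.
rewrite /vertex_product (reindex_inj (@perm_inj _ st.1)); apply: eq_bigr => v _.
by rewrite relabel_vgenus relabel_valence.
Qed.

Lemma sum_stable_reprs g nv nh : (2 <= g)%N ->
  \sum_(G in stable_graph_reprs g nv nh 0) graph_weight G =
  (nv`!%:R * nh`!%:R)^-1 * \sum_(G in stable_graphs g nv nh 0) vertex_product G.
Proof.
move=> g2; apply: (@sum_class_reprs g nv nh _ (@vertex_product g nv nh)).
  have imp G G' : isomorphic G G' -> G \in stable_graphs g nv nh 0 ->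
      G' \in stable_graphs g nv nh 0.
    by case/existsP => st; rewrite is_isoE => /eqP->; apply: relabel_stable_graphs.
  move=> G G' iG; apply/idP/idP; apply: imp => //.
  by rewrite isomorphicE orbit_sym -isomorphicE.
by move=> G G' /existsP[st]; rewrite is_isoE => /eqP->; rewrite relabel_vertex_product.
Qed.

(** A connected graph with a vertex of valence 0 is an isolated vertex, so
    in all other cases valences are positive and cweight_coef applies. *)
Lemma sum_stable_graphs g nv nh : (2 <= g)%N -> ~~ ((nv == 1%N) && (nh == 0%N)) ->
  \sum_(G in stable_graphs g nv nh 0) vertex_product G =
  fcoef (cgraph_sum V_times nv nh) (2 * g - 2).
Proof.
move=> g2 nv1; rewrite fcoef_sum.
have pos (p : pgraph 'I_nv 'I_nh) : matching p && component p [set: 'I_nv] ->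
    forall v, (0 < #|fiber p v|)%N.
  move=> /andP[M /componentP[_ _ minV]] v; rewrite lt0n; apply: contraNneq nv1 => v0.
  have vN h : p.1 h != v.
    by apply/eqP => hv; have := cards0_eq v0; move/setP/(_ h); rewrite !inE hv eqxx.
  have [||/setP/(_ v)|vT] := minV [set v]; first exact: subsetT.
  - by apply/closed_inP => h; rewrite inE (negPf (vN h)).
  - by rewrite !inE eqxx.
  have nvE : nv = 1%N by rewrite -(card_ord nv) -cardsT -vT cards1.
  rewrite nvE eqxx /= -[nh]card_ord -(sum_card_fiber p).
  apply/eqP; rewrite big1 // => w _.
  have : w \in [set v] by rewrite vT inE.
  by rewrite inE => /eqP->.
rewrite [RHS](eq_bigr _ (fun p pM => cweight_coef g2 (pos p pM))).
rewrite pair_big_dep; apply: eq_bigl => G /=.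
by rewrite mem_stable_graphs // -andbA.
Qed.

(** The isolated vertex of genus g: the open stratum of the moduli space. *)
Lemma sum_stable_graphs_point g : (2 <= g)%N ->
  \sum_(G in stable_graphs g 1 0 0) vertex_product G = chiM g 0.
Proof.
move=> g2; pose G0 : graph g 1 0 := ([ffun=> ord0], [ffun h => h], [ffun=> ord_max]).
have val0 G v : valence (G : graph g 1 0) v = 0%N.
  by apply/eqP; rewrite cards_eq0; apply/eqP/setP => -[].
rewrite (big_pred1 G0) => [|G].
  by rewrite /vertex_product big_ord1 val0 /vgenus ffunE.
rewrite mem_stable_graphs //; apply/and4P/eqP => [[_ _ _]|->].
  rewrite big_ord1 val0 => /eqP gE; case: G gE => [[r s] c] gE.
  congr (_, _, _); apply/ffunP => x; first by case: x.
    by case: x.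
  apply/val_inj; rewrite ffunE (ord1 x) /=; move: gE; rewrite /vgenus /=.
  by move: (nat_of_ord _) => k; lia.
split.
- by apply/matchingP => -[].
- apply/componentP; split=> [||B _ _].
  + by apply/set0Pn; exists ord0; rewrite inE.
  + by apply/closed_inP => -[].
  have [->|[v vB]] := set_0Vmem B; [by left|right; apply/setP => w].
  by rewrite inE (ord1 w) -(ord1 v).
- by apply/forallP => v; rewrite val0 /vgenus ffunE /=; lia.
by rewrite big_ord1 val0 /vgenus ffunE /= addn0.
Qed.

Lemma cgraph_sum_point k : fcoef (cgraph_sum V_times 1 0) k = 0.
Proof.
rewrite fcoef_sum big1 // => p _; rewrite cweightT big_ord1.
by rewrite (_ : #|_| = 0%N) //; apply/eqP; rewrite cards_eq0; apply/eqP/setP => -[].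
Qed.

Lemma V_times_low n : low (maxn 1 (n - 2)) (V_times n).
Proof. by case: n => [|n]; [|rewrite (_ : (n.+1 - 2 = n - 1)%N); [exact: V_low|lia]]. Qed.

(** The stable graphs of genus g without legs are the graphs counted by
    connected_series together with the isolated vertex, whose contribution is
    the subtracted term. *)
Lemma chiMbarE g : (2 <= g)%N ->
  chiMbar g 0 - chiM g 0 = fcoef (connected_series V_times) (2 * g - 2).
Proof.
move=> g2; pose N := (3 * (2 * g - 2)).+1.
pose f n m : rat := (n`!%:R * m`!%:R)^-1 * fcoef (cgraph_sum V_times n m) (2 * g - 2).
pose w (p : nat * nat) := \sum_(G in stable_graph_reprs g p.1 p.2 0) graph_weight G.
have wE n m : w (n, m) = f n m + ((n == 1%N) && (m == 0%N))%:R * chiM g 0.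
  rewrite /w /f sum_stable_reprs //=.
  have [/andP[/eqP-> /eqP->]|nm] := boolP ((n == 1%N) && (m == 0%N)).
    by rewrite sum_stable_graphs_point // cgraph_sum_point mulr0 add0r !mul1r.
  by rewrite sum_stable_graphs // mul0r addr0.
have N1 : (1 < N)%N by rewrite /N; lia.
rewrite /chiMbar fact0 mul1r.
rewrite (@fsum_seq _ _ [seq (n, m) | n <- iota 0 N, m <- iota 0 N]) //; first last.
- move=> [n m] _ nm; rewrite -/(w (n, m)) wE.
  have nmN : ~~ ((n < N)%N && (m < N)%N).
    by apply: contra nm => /andP[nN mN]; apply/allpairsP; exists (n, m);
      rewrite !mem_iota.
  rewrite (_ : (n == 1%N) && (m == 0%N) = false) ?mul0r ?addr0; last lia.
  by rewrite /f (low_cgraph_sum V_times_low) ?mulr0 //; move: nmN; rewrite /N; lia.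
- by apply: allpairs_uniq; rewrite ?iota_uniq // => -[? ?] [? ?].
rewrite big_allpairs -[iota 0 N]/(index_iota 0 N) big_mkord.
rewrite (eq_bigr (fun n : 'I_N => \sum_(m < N) f n m +
    \sum_(m < N) ((nat_of_ord n == 1%N) && (nat_of_ord m == 0%N))%:R * chiM g 0)); last first.
  by move=> n _; rewrite big_mkord -big_split; apply: eq_bigr => m _; apply: wE.
rewrite big_split /=.
suff -> : \sum_(n < N) \sum_(m < N)
  ((nat_of_ord n == 1%N) && (nat_of_ord m == 0%N))%:R * chiM g 0 = chiM g 0.
  by rewrite addrK.
rewrite (bigD1 (Ordinal N1)) //= [X in _ + X]big1 ?addr0; last first.
  move=> n n1; rewrite big1 // => m _.
  by rewrite (_ : nat_of_ord n == 1%N = false) ?mul0r //; apply: negbTE n1.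
rewrite (bigD1 (Ordinal (ltnW N1))) //= mul1r big1 ?addr0 // => m m0.
by rewrite (_ : nat_of_ord m == 0%N = false) ?mul0r //; apply: negbTE m0.
Qed.

Lemma connected_series_odd k : odd k -> fcoef (connected_series V_times) k = 0.
Proof.
move=> ok; rewrite /connected_series /= /box_sum big1 // => n _; rewrite big1 // => m _.
by rewrite cgraph_sum_odd ?mulr0.
Qed.

Lemma chi_series :
  fps_sum [set g : nat | (2 <= g)%N]
    (fun g => (chiMbar g 0 - chiM g 0) *: 'u ^+ (2 * g - 2)) =
  connected_series V_times.
Proof.
apply/fpsP => k; have [ok|ek] := boolP (odd k).
  rewrite connected_series_odd // /fps_sum /= (@fsum_seq _ _ [::]) ?big_nil //.
  move=> g _ _; rewrite fcoefXn (_ : k == _ = false) ?mulr0 //.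
  by apply/eqP; lia.
have [->|k0] := eqVneq k 0%N.
  rewrite /fps_sum /= (@fsum_seq _ _ [::]) ?big_nil // => [|g g2 _].
    by symmetry; apply: (connected_series_coef0).
  by rewrite fcoefXn (_ : _ == _ = false) ?mulr0 //;
    apply/eqP; have : (2 <= g)%N := g2; lia.
pose g := (k./2.+1)%N; have kE : k = (2 * g - 2)%N by rewrite /g; lia.
rewrite {2}kE -chiMbarE; last by rewrite /g; lia.
rewrite /fps_sum /= (@fsum_seq _ _ [:: g]) //.
- by rewrite big_seq1 fcoefXn kE eqxx mulr1.
- by move=> i; rewrite inE => /eqP->; rewrite /g /=; lia.
move=> i i2; rewrite inE => ig; rewrite fcoefXn (_ : _ == _ = false) ?mulr0 //.
by apply/eqP; have : (2 <= i)%N := i2; lia.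
Qed.

Theorem theorem6p2 :
  let T (n : nat) : fps := (n`!%:R)^-1 *: V n in
  [/\ fps_summable [set: seq nat] (Z1D_term (KP_times T)),
      fcoef (Z1D (KP_times T)) 0%N = 1
    & fps_sum [set g : nat | (2 <= g)%N]
        (fun g => (chiMbar g 0 - chiM g 0) *: 'u ^+ (2 * g - 2))
      = fps_log (Z1D (KP_times T))].
Proof.
move=> T; have -> : KP_times T = fun k => V k.+1.
  apply/funext => k; rewrite /KP_times /T scalerA mulfV ?scale1r //.
  exact: fact_neq0.
split; first exact: Z1D_summable V_low.
  exact: Z1D_coef0 V_low.
by rewrite chi_series (connected_series_Z1D V_low).
Qed.
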